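(* Let $\alpha > 0$ and let $F(z) = \sum_{n=0}^\infty c_n z^n$ be a formal power series (with real coefficients) with $c_0 = 1$ and $c_1 = c \neq 0$. Define the polynomials $\{P_n : n \geq 0\}$ via the identity of formal power series in $z$ $$F\left(x z - \alpha z^2\right) = \sum_{n=0}^\infty c_n P_n(x) z^n$$ (if $c_n = 0$, then $P_n$ is undefined). These polynomials form an orthogonal polynomial family (in particular, all $P_n$, $n\ge 0$, are defined; the family is automatically monic) if and only if one of the following holds: (i) $\{P_n\}$ are re-scaled ultraspherical polynomials: for some $\lambda > -\frac12$, $\lambda \neq 0$, and some $b > 0$, for all $n \ge 0$, $P_n(x)$ is the monic scalar multiple of $C_n^{(\lambda)}\left(\sqrt{\frac{b}{4\alpha}}\, x\right)$. In this case $$F(z) = 1 + \frac{c}{\lambda b}\left(\frac{1}{(1 - b z)^{\lambda}} - 1\right)$$ with $c \neq 0$. (The choice $c = \lambda$, $b = 1$ gives $F(z) = \frac{1}{(1-z)^\lambda}$.) (ii) $\{P_n\}$ are re-scaled Chebyshev polynomials of the first kind: for some $b > 0$, for all $n\ge 0$, $P_n(x)$ is the monic scalar multiple of $T_n\left(\sqrt{\frac{b}{4\alpha}}\, x\right)$. In this case $$F(z) = 1 + \frac{c}{b}\ln\left(\frac{1}{1 - b z}\right)$$ with $c \neq 0$. (The choice $c = b = 1$ gives $F(z) = 1 + \ln\left(\frac{1}{1-z}\right)$.) (iii) $\{P_n\}$ are re-scaled Hermite polynomials: for some $a > 0$, for all $n \ge 0$, $P_n(x)$ is the monic scalar multiple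 of $H_n\left(\sqrt{\frac{a}{2\alpha}}\, x\right)$. In this case $$F(z) = 1 + \frac{c}{a}\left(e^{a z} - 1\right)$$ with $c \neq 0$. (The choice $c = a = 1$ gives $F(z) = e^z$.)
   Context: An orthogonal polynomial family is a sequence $\{P_n : n \ge 0\}$ of real polynomials with $\deg P_n = n$ that are pairwise orthogonal in $L^2(\mu)$ for some positive Borel measure $\mu$ on $\mathbb{R}$ with infinite support and finite moments of all orders. It is monic if each $P_n$ has leading coefficient $1$. The functions $\frac{1}{(1-bz)^\lambda}$, $\ln\left(\frac{1}{1-bz}\right)$, $e^{az}$ are understood as formal power series in $z$ (their Taylor expansions at $0$). $C_n^{(\lambda)}$ denotes the ultraspherical (Gegenbauer) polynomials, defined (up to a nonzero scalar for each $n$) by $\sum_{n\ge0} C_n^{(\lambda)}(x) z^n = (1 - 2xz + z^2)^{-\lambda}$, for $\lambda > -\frac12$, $\lambda\ne 0$. $T_n$ denotes the Chebyshev polynomials of the first kind, $T_n(\cos\theta) = \cos(n\theta)$ (up to a nonzero scalar for each $n$). $H_n$ denotes the (probabilists') Hermite polynomials, $\sum_{n\ge0} \frac{1}{n!} H_n(x) z^n = \exp(xz - z^2/2)$. The monic scalar multiple of a nonzero polynomial is that polynomial divided by its leading coefficient. *)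

(* Defs.v *)
From HB Require Import structures.
From mathcomp Require Import all_boot all_order all_algebra.
From mathcomp Require Import all_classical all_reals all_analysis.

Set Implicit Arguments.
Unset Strict Implicit.
Unset Printing Implicit Defensive.

Import Order.TTheory GRing.Theory Num.Theory.
Import numFieldNormedType.Exports.

Local Open Scope classical_set_scope.
Local Open Scope ring_scope.

(** A formal power series over [R] is its coefficient sequence [nat -> R].
    [{poly {poly R}}] is R[x][z]: the outer variable is z, the inner one x. *)

Definition taylor0 (R : realType) (f : R -> R) (n : nat) : R :=
  derive1n n f 0 / n`!%:R.

(** The polynomial p x z - q z^2 of R[x][z]. *)
Definition xz_sub_zz (R : realType) (p q : R) : {poly {poly R}} :=
  (p *: 'X) *: 'X - q%:P *: 'X^2.

(** The coefficient of z^n in sum_k F_k u(z)^k.  Only meaningful when u has no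
    constant term in z: then u^k has z-order at least k, so that the terms with
    k > n do not contribute. *)
Definition coef_subst (R : realType) (F : nat -> R) (u : {poly {poly R}})
    (n : nat) : {poly R} :=
  \sum_(k < n.+1) F k *: (u ^+ k)`_n.

(** P_n, determined by F(x z - alpha z^2) = sum_n F_n P_n(x) z^n; it is
    undefined ([None]) when F_n = 0. *)
Definition genP (R : realType) (alpha : R) (F : nat -> R) (n : nat) :
    option {poly R} :=
  if F n == 0 then None
  else Some ((F n)^-1 *: coef_subst F (xz_sub_zz 1 alpha) n).

Definition measure_support (R : realType)
    (mu : {measure set (measurableTypeR R) -> \bar R}) : set R :=
  [set x : R | forall U : set R, open U -> U x -> (0 < mu U)%E].

Definition orthogonal_polynomial_family (R : realType) (P : nat -> {poly R}) :
    Prop :=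
  (forall n, size (P n) = n.+1) /\
  exists mu : {measure set (measurableTypeR R) -> \bar R},
    [/\ infinite_set (measure_support mu),
        forall k : nat, mu.-integrable setT (fun x : R => (x ^+ k)%:E)
      & forall m n : nat, m <> n ->
          (\int[mu]_x ((P m).[x] * (P n).[x])%:E = 0)%E].

Definition is_OPF (R : realType) (P : nat -> option {poly R}) : Prop :=
  exists Q : nat -> {poly R},
    (forall n, P n = Some (Q n)) /\ orthogonal_polynomial_family Q.

Definition monic_multiple (R : realType) (p : {poly R}) : {poly R} :=
  (lead_coef p)^-1 *: p.

(** sum_n C_n(x) z^n = (1 - 2 x z + z^2)^(-lambda), i.e. the Taylor series of
    (1 - w)^(-lambda) at w = 2 x z - z^2. *)
Definition gegenbauer (R : realType) (lambda : R) (n : nat) : {poly R} :=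
  coef_subst (taylor0 (fun w : R => 1 / (1 - w) `^ lambda)) (xz_sub_zz 2 1) n.

Definition is_chebyshevT (R : realType) (n : nat) (p : {poly R}) : Prop :=
  forall theta : R, p.[cos theta] = cos (n%:R * theta).

(** sum_n H_n(x) z^n / n! = exp(x z - z^2 / 2). *)
Definition hermite (R : realType) (n : nat) : {poly R} :=
  n`!%:R *: coef_subst (taylor0 (@expR R)) (xz_sub_zz 1 2^-1) n.

Definition rescaled_ultraspherical (R : realType) (alpha lambda b : R)
    (P : nat -> option {poly R}) : Prop :=
  forall n, P n = Some (monic_multiple
    (gegenbauer lambda n \Po (Num.sqrt (b / (4 * alpha)) *: 'X))).

Definition rescaled_chebyshevT (R : realType) (alpha b : R)
    (P : nat -> option {poly R}) : Prop :=
  forall n, exists2 T : {poly R}, is_chebyshevT n T &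
    P n = Some (monic_multiple (T \Po (Num.sqrt (b / (4 * alpha)) *: 'X))).

Definition rescaled_hermite (R : realType) (alpha a : R)
    (P : nat -> option {poly R}) : Prop :=
  forall n, P n = Some (monic_multiple
    (hermite R n \Po (Num.sqrt (a / (2 * alpha)) *: 'X))).

Definition F_ultraspherical (R : realType) (c lambda b : R) (z : R) : R :=
  1 + c / (lambda * b) * (1 / (1 - b * z) `^ lambda - 1).

Definition F_chebyshevT (R : realType) (c b : R) (z : R) : R :=
  1 + c / b * ln (1 / (1 - b * z)).

Definition F_hermite (R : realType) (c a : R) (z : R) : R :=
  1 + c / a * (expR (a * z) - 1).

(* Main.v *)
Require Import Defs.
From HB Require Import structures.
From mathcomp Require Import all_boot all_order all_algebra.
From mathcomp Require Import all_classical all_reals all_analysis.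
From mathcomp Require Import measurable_realfun ring lra zify.

Set Implicit Arguments.
Unset Strict Implicit.
Unset Printing Implicit Defensive.

Import Order.TTheory GRing.Theory Num.Theory.
Import numFieldNormedType.Exports.

Local Open Scope ring_scope.

(** Expanding F (x z - alpha z^2) gives, with F_n the coefficients of F,
      F_n P_n(x) = sum_j F_(n-j) C(n-j, j) (- alpha)^j x^(n - 2 j),
    so everything can be read off the coefficient sequence F.

    Suppose that the P_n are orthogonal.  They are monic and have the parity of
    their index, so they satisfy P_(n+2) = x P_(n+1) - omega_n P_n with
    omega_n > 0 ([three_term]).  Comparing the coefficients of x^n and of
    x^(n-2) shows that s_n = n F_n / F_(n-1) has vanishing second differences
    for n >= 2, i.e. s_n = A + B n, while positivity of the omega_n amounts to
    B >= 0 and 2 A + 3 B > 0 ([coef_ratio_affine]).  The recurrence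
    n F_n = (A + B n) F_(n-1), n >= 2, leaves F_1 free and has three kinds of
    solutions: exponential (B = 0), logarithmic (B > 0, A = - B) and binomial
    (B > 0, A = B (lambda - 1) with lambda > - 1/2).  These are the three
    families, because two sequences F and G generate the same polynomials up to
    rescaling exactly when F_n is proportional to b^n G_n for n >= 1
    ([genP_eq_monic_multiple]); the factor is what the parameter c records.

    Conversely the recurrence turns into the differential equation
      (4 alpha - B x^2) y'' - (2 A + 3 B) x y' + e_n y = 0
    for y = P_n ([monic_ode]), with pairwise distinct eigenvalues e_n.  The
    operator is symmetric for any measure that satisfies the Pearson identity
      integral of (4 alpha - B x^2) p' - (2 A + 3 B) x p = 0
    for every polynomial p, and eigenvectors for distinct eigenvalues are then
    orthogonal ([ode_orthogonal]).  For B = 0 the Gaussian measure has this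
    property ([gaussian_measure]).  For B > 0 it is the weight
    (rho^2 - x^2)^(eps/2 - 1) on [- rho, rho], where eps = 2 lambda + 1 can be any
    positive number; the substitution x = rho (1 - t^(2/eps)) absorbs the
    singularity at the end point, so that the measure is built from a continuous density on [0, 1]
    ([jacobi_measure], [ultraspherical_measure]). *)

(** * Coefficients of the generated polynomials *)

Section Coefficients.
Variable R : realType.
Implicit Types (F : nat -> R) (p q s : R).

Lemma coef_linear_exp (A : comNzRingType) (a b : A) k m :
  ((a%:P + b *: 'X) ^+ k)`_m = a ^+ (k - m) * b ^+ m *+ 'C(k, m).
Proof.
rewrite exprDn coef_sum.
rewrite (eq_bigr (fun i : 'I_k.+1 =>
   (m == i)%:R * (a ^+ (k - m) * b ^+ m *+ 'C(k, m)))); last first.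
  move=> i _; rewrite coefMn -polyC_exp exprZn coefCM coefZ coefXn.
  by case: eqVneq => [->|_]; rewrite ?mulr1 ?mul1r // !mulr0 mul0rn mul0r.
have [lemk|ltkm] := leqP m k.
  rewrite (bigD1 (inord m)) //= inordK ?ltnS // eqxx mul1r big1 ?addr0 // => i.
  by rewrite -val_eqE /= inordK ?ltnS // eq_sym => /negbTE ->; rewrite mul0r.
by rewrite bin_small // mulr0n big1 // => i _; rewrite mulr0.
Qed.

Lemma xz_sub_zzE p q :
  xz_sub_zz p q = 'X * ((p *: 'X)%:P + (- q)%:P *: 'X).
Proof.
rewrite mulrDr polyCN scaleNr mulrN -scalerAr -expr2; congr (_ - _).
by rewrite [RHS]mulrC mul_polyC.
Qed.

(** Powers of a series without constant term in z have increasing z-order; this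
    is why the truncated sum in [coef_subst] is the full coefficient. *)
Lemma coef_xz_sub_zz_exp_lt p q k n : (n < k)%N -> ((xz_sub_zz p q) ^+ k)`_n = 0.
Proof. by move=> ltnk; rewrite xz_sub_zzE exprMn coefXnM ltnk. Qed.

Lemma coef_xz_sub_zz_exp p q k n : (k <= n)%N ->
  ((xz_sub_zz p q) ^+ k)`_n =
  ('C(k, n - k)%:R * (- q) ^+ (n - k) * p ^+ (k - (n - k))) *: 'X^(k - (n - k)).
Proof.
move=> lekn.
rewrite xz_sub_zzE exprMn coefXnM ltnNge lekn /= coef_linear_exp exprZn -polyC_exp.
by rewrite mulrC mul_polyC scalerA -scaler_nat scalerA mulrA.
Qed.

Lemma coef_substE F p q n :
  coef_subst F (xz_sub_zz p q) n =
  \sum_(j < n.+1) (F (n - j)%N * 'C(n - j, j)%:R * (- q) ^+ j * p ^+ (n - j.*2))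
     *: 'X^(n - j.*2).
Proof.
rewrite /coef_subst (reindex_inj rev_ord_inj) /=; apply: eq_bigr => j _.
have jn : (j <= n)%N by rewrite -ltnS.
rewrite subSS coef_xz_sub_zz_exp ?leq_subr // subKn // -subnDA addnn.
by rewrite scalerA !mulrA.
Qed.

(** The coefficient of x^m in the coefficient of z^n: a term x^m z^n comes from
    n - m = 2 j, that is from choosing the summand q z^2 exactly j times. *)
Lemma coef_coef_subst F p q n m :
  (coef_subst F (xz_sub_zz p q) n)`_m =
  if (m <= n)%N && ~~ odd (n - m) then
    F (n - (n - m)./2)%N * 'C(n - (n - m)./2, (n - m)./2)%:R
      * (- q) ^+ (n - m)./2 * p ^+ m
  else 0.
Proof.
rewrite coef_substE coef_sum.
case: ifP => [/andP[lemn even_nm]|nodd].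
  have e2 : ((n - m)./2.*2 = n - m)%N by rewrite even_halfK.
  have ltj : ((n - m)./2 < n.+1)%N by lia.
  rewrite (bigD1 (Ordinal ltj)) //= big1 => [|i].
    by rewrite addr0 coefZ coefXn e2 subKn // eqxx mulr1.
  rewrite -val_eqE /= => /eqP ni; rewrite coefZ coefXn.
  have [lt|ge] := ltnP n i.*2.
    by rewrite (@bin_small (n - i)) ?mulr0 ?mul0r //; lia.
  case: eqP => [e|_]; last by rewrite mulr0.
  by case: ni; lia.
rewrite big1 // => i _; rewrite coefZ coefXn.
have [lt|ge] := ltnP n i.*2.
  by rewrite (@bin_small (n - i)) ?mulr0 ?mul0r //; lia.
case: eqP => [e|_]; last by rewrite mulr0.
by move/negbT: nodd; rewrite negb_and; case/orP; lia.
Qed.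

Lemma coef_coef_substB F p q n j : (j.*2 <= n)%N ->
  (coef_subst F (xz_sub_zz p q) n)`_(n - j.*2) =
  F (n - j)%N * 'C(n - j, j)%:R * (- q) ^+ j * p ^+ (n - j.*2).
Proof.
move=> lejn; rewrite coef_coef_subst leq_subr subKn // odd_double /=.
by rewrite doubleK.
Qed.

Lemma size_coef_subst F p q n : F n != 0 -> p != 0 ->
  size (coef_subst F (xz_sub_zz p q) n) = n.+1.
Proof.
move=> Fn p0; apply/eqP; rewrite eqn_leq; apply/andP; split.
  by apply/leq_sizeP => m ltnm; rewrite coef_coef_subst leqNgt ltnm.
rewrite ltnNge; apply/negP => /leq_sizeP /(_ _ (leqnn n)) /eqP.
rewrite coef_coef_subst leqnn subnn /= subn0 bin0 expr0 !mulr1.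
by rewrite mulf_eq0 (negbTE Fn) /= expf_eq0 (negbTE p0) andbF.
Qed.

Lemma lead_coef_coef_subst F p q n : F n != 0 -> p != 0 ->
  lead_coef (coef_subst F (xz_sub_zz p q) n) = F n * p ^+ n.
Proof.
move=> Fn p0; rewrite lead_coefE size_coef_subst //= coef_coef_subst leqnn subnn /=.
by rewrite subn0 bin0 expr0 !mulr1.
Qed.

End Coefficients.

(** * Monic multiples and rescaling *)

Section MonicRescaling.
Variable R : realType.
Implicit Types (F G : nat -> R) (p q s b alpha : R).

Lemma coef_subst_comp_scale F p q s n :
  coef_subst F (xz_sub_zz p q) n \Po (s *: 'X) =
  coef_subst F (xz_sub_zz (p * s) q) n.
Proof.
rewrite !coef_substE raddf_sum /=; apply: eq_bigr => j _.
by rewrite comp_polyZ comp_Xn_poly exprZn scalerA exprMn mulrA.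
Qed.

Lemma monic_multipleZ (k : R) (P : {poly R}) : k != 0 ->
  monic_multiple (k *: P) = monic_multiple P.
Proof.
move=> k0; rewrite /monic_multiple lead_coefZ scalerA invfM mulrAC mulVf //.
by rewrite mul1r.
Qed.

Lemma monic_multiple_coef_subst G p q n : G n != 0 -> p != 0 ->
  monic_multiple (coef_subst G (xz_sub_zz p q) n) =
  (G n * p ^+ n)^-1 *: coef_subst G (xz_sub_zz p q) n.
Proof. by move=> Gn p0; rewrite /monic_multiple lead_coef_coef_subst. Qed.

Lemma genP_Some alpha F n : F n != 0 ->
  genP alpha F n = Some (monic_multiple (coef_subst F (xz_sub_zz 1 alpha) n)).
Proof.
move=> Fn; rewrite /genP (negbTE Fn) monic_multiple_coef_subst ?oner_eq0 //.
by rewrite expr1n mulr1.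
Qed.

Lemma genP_neq0 alpha F n P : genP alpha F n = Some P -> F n != 0.
Proof. by rewrite /genP; case: eqP. Qed.

(** Only the ratios F_(n-j) / F_n enter the monic polynomials, and alpha and
    q / (p s)^2 = alpha / b enter through their j-th powers.  So the two sides
    agree iff F_n / F_(n-1) = b G_n / G_(n-1) for n >= 2; nothing ties F_1 to
    F_0, whence the free factor. *)
Lemma genP_eq_monic_multiple F G alpha b p q s :
    F 0%N = 1 -> F 1%N != 0 -> (forall n, G n != 0) ->
    alpha != 0 -> b != 0 -> p != 0 -> s != 0 ->
    q * b = alpha * (p * s) ^+ 2 ->
  (forall n, genP alpha F n = Some (monic_multiple
     (coef_subst G (xz_sub_zz p q) n \Po (s *: 'X)))) <->
  (forall n, F n.+1 = F 1%N / (b * G 1%N) * (b ^+ n.+1 * G n.+1)).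
Proof.
move=> F0 F1 G_neq0 a0 b0 p0 s0 qb.
have P0 : p * s != 0 by rewrite mulf_neq0.
set t := p * s in qb P0 *.
have G1 := G_neq0 1%N.
split=> [PE|FE].
  have F_neq0 n : F n != 0 by exact: genP_neq0 (PE n).
  elim=> [|n IHn]; first by rewrite expr1; field; rewrite b0 G1.
  (* compare the coefficients of x^n in degree n + 2 *)
  have := PE n.+2; rewrite genP_Some // coef_subst_comp_scale -/t.
  rewrite !monic_multiple_coef_subst ?oner_eq0 // => -[].
  move=> /(congr1 (fun P : {poly R} => P`_(n.+2 - 1.*2))).
  rewrite !coefZ !coef_coef_substB // !subSS !subn0 bin1 !expr1n !expr1.
  rewrite !mulr1 => e.
  have {}e : F n.+1 / F n.+2 * alpha = G n.+1 / G n.+2 * q / t ^+ 2.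
    have nz : - n.+1%:R != 0 :> R by rewrite oppr_eq0 pnatr_eq0.
    apply: (mulfI nz); move: e; rewrite !exprS => e.
    transitivity ((F n.+2)^-1 * (F n.+1 * n.+1%:R * - alpha)); first by ring.
    rewrite e; field.
    by rewrite P0 G_neq0 expf_neq0.
  have qE : q = alpha * t ^+ 2 / b by rewrite -qb mulfK.
  have {}e : F n.+1 / F n.+2 = G n.+1 / G n.+2 / b.
    apply: (mulIf a0); rewrite e qE; field.
    by rewrite P0 G_neq0 b0.
  have -> : F n.+2 = F n.+1 * (F n.+1 / F n.+2)^-1.
    by rewrite invf_div mulrC divfK.
  rewrite e IHn (exprS b n.+1) invf_div invf_div; field.
  by rewrite !G_neq0 b0.
have K0 : F 1%N / (b * G 1%N) != 0 by rewrite mulf_neq0 ?invr_neq0 ?mulf_neq0.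
have F_neq0 n : F n != 0.
  case: n => [|n]; first by rewrite F0 oner_eq0.
  by rewrite FE mulf_neq0 // mulf_neq0 // expf_neq0.
(* for i = n the condition forces n = 0, so F_0 is never compared with F_n, n > 0 *)
have ratio i n : (i.*2 <= n)%N -> F (n - i)%N / F n = G (n - i)%N / G n / b ^+ i.
  case: n => [|n] le_in.
    have -> : i = 0%N by lia.
    by rewrite subn0 !divff // expr0 divr1.
  have -> : (n.+1 - i = (n - i).+1)%N by lia.
  have -> : F n.+1 = F 1%N / (b * G 1%N) * (b ^+ i * b ^+ (n - i).+1 * G n.+1).
    by rewrite FE -exprD; congr (_ * (_ ^+ _ * _)); lia.
  rewrite FE; field.
  by rewrite !G_neq0 !expf_neq0 ?b0.
move=> n; rewrite genP_Some // coef_subst_comp_scale -/t; congr Some.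
rewrite !monic_multiple_coef_subst ?oner_eq0 //; apply/polyP => m.
rewrite !coefZ !coef_coef_subst; case: ifP => [/andP[lemn even_nm]|]; last first.
  by rewrite !mulr0.
have nE : n = (m + (n - m)./2.*2)%N by rewrite even_halfK // subnKC.
move: (n - m)./2 nE => {even_nm} j nE.
rewrite !expr1n !mulr1.
have qE : q = alpha * t ^+ 2 / b by rewrite -qb mulfK.
have -> : t ^+ n = t ^+ m * t ^+ j * t ^+ j.
  by rewrite -!exprD; congr (_ ^+ _); lia.
rewrite qE (exprNn alpha) (exprNn (alpha * _ / _)).
have le_jn : (j.*2 <= n)%N by rewrite nE leq_addl.
have rj := ratio j n le_jn; clear nE.
transitivity (F (n - j)%N / F n * ('C(n - j, j)%:R * ((-1) ^+ j * alpha ^+ j))).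
  by ring.
rewrite rj !exprMn exprVn; field.
by rewrite !expf_neq0 ?G_neq0.
Qed.

End MonicRescaling.

(** * Taylor coefficients of powers and logarithms *)

Section Taylor.
Local Open Scope classical_set_scope.
Variable R : realType.
Implicit Types (w : R) (f : R -> R) (h : nat -> R -> R) (b k lambda : R).

(** Iterated derivatives only depend on a neighbourhood, so a closed form that is
    valid on an open set (here the half-line left of the singularity) suffices. *)
Lemma derive1n_chain (U : set R) f h : open U ->
  (forall x, U x -> f x = h 0%N x) ->
  (forall n x, U x -> is_derive x 1 (h n) (h n.+1 x)) ->
  forall n x, U x -> derive1n n f x = h n x.
Proof.
move=> oU f0 dh; elim=> [|n IHn] x Ux; first by rewrite derive1n0 f0.
rewrite derive1nS derive1E (@near_eq_derive _ _ _ _ (h n)).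
  by have := dh n x Ux => -[_ ->].
by apply: (filterS IHn); exact: open_nbhs_nbhs.
Qed.

Lemma taylor0_0 f : taylor0 f 0 = f 0.
Proof. by rewrite /taylor0 derive1n0 fact0 divr1. Qed.

(** One lemma for all series at hand: each is an affine function of h_0 (b z), with
    h_0 a power, a logarithm or the exponential. *)
Lemma taylor0_affine f h k0 k b n :
  (forall (m : nat) (w : R), w < 1 -> is_derive w 1 (h m) (h m.+1 w)) ->
  (forall z, f z = k0 + k * h 0%N (b * z)) ->
  taylor0 f n.+1 = k * b ^+ n.+1 * (h n.+1 0 / n.+1`!%:R).
Proof.
move=> dh fE.
pose U := [set z : R | b * z < 1].
pose g m z := (if m is 0%N then k0 else 0) + k * b ^+ m * h m (b * z).
have oU : open U.
  have -> : U = ( *%R b) @^-1` [set z | z < 1] by [].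
  apply: open_comp => [x _|]; last exact: open_lt.
  exact: mulrl_continuous.
have dg m x : U x -> is_derive x 1 (g m) (g m.+1 x).
  move=> Ux; have dhm := dh m (b * x) Ux.
  have db : is_derive x 1 ( *%R b) b.
    by apply: is_derive_eq; rewrite /GRing.scale /= mulr1.
  have dc := @is_derive1_comp _ (h m) ( *%R b) x _ _ dhm db.
  rewrite /g; apply: is_derive_eq.
  by rewrite /GRing.scale /= add0r exprSr; ring.
rewrite /taylor0 (derive1n_chain oU _ dg) //.
- by rewrite /g mulr0 add0r mulrA.
- by move=> x _; rewrite /g expr0 mulr1 fE.
- by rewrite /U /= mulr0 ltr01.
Qed.

Definition pochhammer lambda n : R := \prod_(i < n) (lambda + i%:R).

Definition ultra_coef lambda n : R := pochhammer lambda n / n`!%:R.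

(** The n-th derivative of (1 - w)^(- lambda). *)
Definition ultra_der lambda n (w : R) : R :=
  pochhammer lambda n * (1 - w) `^ (- (lambda + n%:R)).

Lemma pochhammerS lambda n :
  pochhammer lambda n.+1 = pochhammer lambda n * (lambda + n%:R).
Proof. by rewrite /pochhammer big_ord_recr. Qed.

Lemma pochhammer0 lambda : pochhammer lambda 0 = 1.
Proof. by rewrite /pochhammer big_ord0. Qed.

Lemma is_derive_ultra_der lambda n w : w < 1 ->
  is_derive w 1 (ultra_der lambda n) (ultra_der lambda n.+1 w).
Proof.
move=> w1; have w0 : 0 < 1 - w by rewrite subr_gt0.
have dp := is_derive1_powR (- (lambda + n%:R)) w0.
have dw : is_derive w 1 (fun w : R => 1 - w) (-1).
  by apply: is_derive_eq; rewrite add0r mul1r.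
have dc := @is_derive1_comp _ (fun x : R => x `^ (- (lambda + n%:R)))
  (fun x : R => 1 - x) w _ _ dp dw.
rewrite /ultra_der; apply: is_derive_eq.
rewrite /GRing.scale /= pochhammerS.
have -> : - (lambda + n.+1%:R) = - (lambda + n%:R) - 1 by ring.
ring.
Qed.

(** The n-th derivative of ln (1 / (1 - w)). *)
Definition log_der n (w : R) : R :=
  if n is m.+1 then m`!%:R / (1 - w) ^+ m.+1 else ln (1 / (1 - w)).

Lemma is_derive_log_der n w : w < 1 ->
  is_derive w 1 (log_der n) (log_der n.+1 w).
Proof.
move=> w1; have w0 : 0 < 1 - w by rewrite subr_gt0.
have w0' : 1 - w != 0 by rewrite gt_eqF.
have dw : is_derive w 1 (fun w : R => 1 - w) (-1).
  by apply: is_derive_eq; rewrite add0r mul1r.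
case: n => [|n].
  have dl := is_derive1_ln w0.
  have dc := @is_derive1_comp _ (@ln R) (fun x : R => 1 - x) w _ _ dl dw.
  have -> : log_der 0 = (fun w => - ln (1 - w)).
    apply/funext => x; rewrite /log_der div1r.
    have [x0|x0] := ltP 0 (1 - x); first by rewrite lnV.
    by rewrite !ln0 ?oppr0 // invr_le0.
  apply: is_derive_eq.
  by rewrite /log_der fact0 expr1; field.
have := is_deriveX n.+1 dw; rewrite exprfctE => de.
have dv := @is_deriveV _ (fun x : R => (1 - x) ^+ n.+1) w _ 1 (expf_neq0 n.+1 w0') de.
rewrite /log_der; apply: is_derive_eq.
rewrite /GRing.scale /= factS natrM !exprS; field.
by rewrite w0' expf_neq0.
Qed.

End Taylor.

(** * Chebyshev polynomials of the first kind *)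

Section ChebyshevT.
Variable R : realType.
Local Notation u := (@xz_sub_zz R 2 1).
Local Notation chebU n := (coef_subst (fun=> 1 : R) u n).

Lemma coef_xz_sub_zzM p q (Y : {poly {poly R}}) n :
  (xz_sub_zz p q * Y)`_n.+2 = (p *: 'X) * Y`_n.+1 - q *: Y`_n.
Proof.
rewrite /xz_sub_zz mulrBl -!scalerAl coefB !coefZ coefXM coefXnM /= subSS.
by rewrite subn1 /= mul_polyC scalerAl.
Qed.

Lemma chebU_widen n M : (n < M)%N -> chebU n = \sum_(k < M) (u ^+ k)`_n.
Proof.
move=> ltnM; rewrite /coef_subst.
under eq_bigr do rewrite scale1r.
rewrite -(big_mkord xpredT (fun k => (u ^+ k)`_n)).
rewrite -(big_mkord xpredT (fun k => (u ^+ k)`_n)).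
rewrite [RHS](big_cat_nat _ ltnM) //= [X in _ = _ + X]big_nat_cond.
by rewrite [X in _ = _ + X]big1 ?addr0 // => k /andP[/andP[/coef_xz_sub_zz_exp_lt ->]].
Qed.

(** U = 1 / (1 - u) satisfies U = 1 + u U. *)
Lemma chebUSS n : chebU n.+2 = (2 *: 'X) * chebU n.+1 - chebU n.
Proof.
rewrite (@chebU_widen _ n.+3) // big_ord_recl /= expr0 coef1 add0r.
rewrite (@chebU_widen n.+1 n.+2) // (@chebU_widen n n.+2) // mulr_sumr -sumrB.
by apply: eq_bigr => k _; rewrite /= /bump /= add1n exprS coef_xz_sub_zzM scale1r.
Qed.

Lemma chebU0 : chebU 0 = 1.
Proof. by rewrite /coef_subst big_ord1 expr0 coef1 scale1r. Qed.

Lemma chebU1 : chebU 1 = 2 *: 'X.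
Proof.
rewrite /coef_subst !big_ord_recl big_ord0 expr0 /= expr1 coef1 scaler0 add0r.
by rewrite addr0 scale1r coefB !coefZ coefX coefXn /= mulr1 mulr0 subr0.
Qed.

(** The coefficients of ln (1 / (1 - w)), with the constant term replaced by 1 so
    that the polynomial of index 0 is T_0 instead of 0. *)
Definition cheb_coef (n : nat) : R := if n is 0%N then 1 else n%:R^-1.

Lemma cheb_coef_neq0 n : cheb_coef n != 0.
Proof. by case: n => [|n] /=; rewrite ?oner_eq0 // invr_neq0 // pnatr_eq0. Qed.

(** Comparing coefficients in z d/dz (- ln (1 - u)) = z u' / (1 - u), where
    u = 2 x z - z^2: this is n S_n = 2 (x U_(n-1) - U_(n-2)) = 2 T_n. *)
Lemma coef_subst_cheb n :
  (n.+2%:R : R) *: coef_subst cheb_coef u n.+2 =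
  2 *: ('X * chebU n.+1 - chebU n).
Proof.
rewrite [in LHS]/coef_subst big_ord_recl /= expr0 coef1 scaler0 add0r scaler_sumr.
rewrite (@chebU_widen n.+1 n.+2) // (@chebU_widen n n.+2) // mulr_sumr -sumrB.
rewrite scaler_sumr; apply: eq_bigr => k _; rewrite /bump /= add1n.
have -> : (n.+2%:R : R) *: ((k.+1%:R^-1 : R) *: (u ^+ k.+1)`_n.+2) =
          (k.+1%:R^-1 : R) *: ((u ^+ k.+1)^`())`_n.+1.
  rewrite coef_deriv; set Q : {poly R} := (u ^+ _)`_ _.
  have swap (a b : R) (P : {poly R}) : a *: (b *: P) = b *: (a *: P).
    by rewrite !scalerA mulrC.
  by rewrite swap scaler_nat.
have cancel (P : {poly R}) : (k.+1%:R^-1 : R) *: (P *+ k.+1) = P.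
  by rewrite -scalerMnr scalerMnl -mulr_natr mulVf ?pnatr_eq0 // scale1r.
rewrite deriv_exp coefMn cancel /=.
have -> : u^`() = (2 *: 'X)%:P - 2 *: 'X.
  rewrite derivB !derivZ derivX derivXn /= expr1 alg_polyC polyC1 scale1r.
  by congr (_ - _); rewrite [RHS]scaler_nat.
rewrite mulrBl coefB coefCM -!scalerAl coefZ coefXM /=.
rewrite scalerBr; congr (_ - _).
by rewrite mulr_natl [RHS]scaler_nat.
Qed.

Lemma cos_step (x y : R) : cos (x + y + y) = 2 * cos y * cos (x + y) - cos x.
Proof.
have -> : cos x = cos (x + y - y) by rewrite addrK.
by rewrite (cosD (x + y)) (cosB (x + y)); ring.
Qed.

Lemma is_chebyshevT_cheb n :
  is_chebyshevT n.+2 ('X * chebU n.+1 - chebU n : {poly R}).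
Proof.
move=> theta; pose C k := cos (k%:R * theta).
have Crec k : C k.+2 = 2 * cos theta * C k.+1 - C k.
  have e1 : k.+1%:R * theta = k%:R * theta + theta by ring.
  have e2 : k.+2%:R * theta = k%:R * theta + theta + theta by ring.
  by rewrite /C e2 cos_step -e1.
have C0 : C 0%N = 1 by rewrite /C mul0r cos0.
have C1 : C 1%N = cos theta by rewrite /C mul1r.
suff: (('X * chebU n.+1 - chebU n).[cos theta] = C n.+2) /\
      (('X * chebU n.+2 - chebU n.+1).[cos theta] = C n.+3) by case.
elim: n => [|n [IH1 IH2]].
  rewrite !Crec C1 C0 chebUSS chebU1 chebU0 !hornerE /=; split; ring.
split=> //; rewrite Crec -IH2 -IH1 !(chebUSS n.+1) !(chebUSS n) !hornerE /=; ring.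
Qed.

(** The values cos (1 / (i + 1)) are pairwise distinct, so two polynomials with the
    same values at all cosines coincide. *)
Lemma is_chebyshevT_unique n (T S : {poly R}) :
  is_chebyshevT n T -> is_chebyshevT n S -> T = S.
Proof.
move=> hT hS; apply/eqP; rewrite -subr_eq0; apply/negPn/negP => D0.
pose M := size (T - S).
pose xs : seq R := [seq cos (i.+1%:R^-1) | i <- iota 0 M].
have xs_uniq : uniq xs.
  rewrite map_inj_in_uniq ?iota_uniq // => i j _ _ eq_ij.
  have in0pi k : (k.+1%:R^-1 : R) \in `[0, pi].
    rewrite in_itv /= invr_ge0 ler0n /= (@le_trans _ _ 1) //.
      by rewrite invf_le1 ?ltr0n // ler1n.
    by rewrite (le_trans _ (pi_ge2 R)) // ler1n.
  have := cos_inj (in0pi i) (in0pi j) eq_ij.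
  by move=> /invr_inj/eqP; rewrite eqr_nat => /eqP [].
have roots : all (root (T - S)) xs.
  by apply/allP => _ /mapP[i _ ->]; rewrite rootE !hornerE hT hS subrr.
by have := max_poly_roots D0 roots xs_uniq; rewrite size_map size_iota ltnn.
Qed.

Lemma chebyshevT_coef_subst n : exists2 k : R, k != 0 &
  is_chebyshevT n (k *: coef_subst cheb_coef u n).
Proof.
case: n => [|[|n]].
- exists 1; rewrite ?oner_eq0 // scale1r /coef_subst big_ord1 expr0 coef1.
  by move=> theta; rewrite /= scale1r hornerC mul0r cos0.
- exists 2^-1; rewrite ?invr_eq0 ?pnatr_eq0 //.
  have -> : coef_subst cheb_coef u 1 = chebU 1.
    rewrite /coef_subst !big_ord_recl !big_ord0 /=.
    by rewrite invr1.
  move=> theta; rewrite chebU1 scalerA mulVf ?pnatr_eq0 // scale1r hornerX.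
  by rewrite mul1r.
exists (2^-1 * n.+2%:R); first by rewrite mulf_neq0 ?invr_eq0 ?pnatr_eq0.
rewrite -scalerA coef_subst_cheb scalerA mulVf ?pnatr_eq0 // scale1r.
exact: is_chebyshevT_cheb.
Qed.

Lemma rescaled_chebyshevTP (alpha b : R) P :
  rescaled_chebyshevT alpha b P <->
  forall n, P n = Some (monic_multiple (coef_subst cheb_coef u n
      \Po (Num.sqrt (b / (4 * alpha)) *: 'X))).
Proof.
split=> PE n; have [k k0 kT] := chebyshevT_coef_subst n.
  have [T hT ->] := PE n; rewrite (is_chebyshevT_unique hT kT).
  by rewrite comp_polyZ monic_multipleZ.
by eexists; [exact: kT|rewrite PE comp_polyZ monic_multipleZ].
Qed.

End ChebyshevT.

(** * The coefficient sequences of the three families *)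

Section ClassicalSeries.
Variable R : realType.
Implicit Types (alpha lambda a b c : R) (F : nat -> R).

Lemma taylor0_ultra_der lambda k0 k b n (f : R -> R) :
  (forall z, f z = k0 + k * (1 / (1 - b * z) `^ lambda)) ->
  taylor0 f n.+1 = k * b ^+ n.+1 * ultra_coef lambda n.+1.
Proof.
move=> fE; rewrite (taylor0_affine n (is_derive_ultra_der lambda) (k0 := k0) (k := k) (b := b)).
  by rewrite /ultra_der subr0 powR1 mulr1.
by move=> z; rewrite fE /ultra_der pochhammer0 mul1r addr0 powRN div1r.
Qed.

Lemma taylor0_log_der k0 k b n (f : R -> R) :
  (forall z, f z = k0 + k * ln (1 / (1 - b * z))) ->
  taylor0 f n.+1 = k * b ^+ n.+1 * n.+1%:R^-1.
Proof.
move=> fE; rewrite (taylor0_affine n (@is_derive_log_der R) fE).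
rewrite /log_der subr0 expr1n divr1; congr (_ * _).
by rewrite factS natrM invfM mulrCA mulfV ?mulr1 //.
Qed.

Lemma taylor0_expR k0 k b n (f : R -> R) :
  (forall z, f z = k0 + k * expR (b * z)) ->
  taylor0 f n.+1 = k * b ^+ n.+1 * n.+1`!%:R^-1.
Proof.
move=> fE.
have dexp (m : nat) (w : R) : w < 1 -> is_derive w 1 (@expR R) (expR w).
  by move=> _; exact: is_derive_expR.
by rewrite (taylor0_affine n (h := fun=> @expR R) dexp fE) expR0 div1r.
Qed.

Lemma taylor0_ultraE lambda :
  taylor0 (fun w : R => 1 / (1 - w) `^ lambda) = ultra_coef lambda.
Proof.
apply/funext => -[|n].
  by rewrite taylor0_0 subr0 powR1 /ultra_coef pochhammer0.
rewrite (@taylor0_ultra_der lambda 0 1 1) ?expr1n ?mul1r // => z.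
by rewrite add0r !mul1r.
Qed.

Lemma taylor0_expRE : taylor0 (@expR R) = (fun n => n`!%:R^-1).
Proof.
apply/funext => -[|n]; first by rewrite taylor0_0 expR0 fact0 invr1.
rewrite (@taylor0_expR 0 1 1) ?expr1n ?mul1r // => z.
by rewrite add0r !mul1r.
Qed.

Lemma ultra_coef_neq0 lambda n : - 2^-1 < lambda -> lambda != 0 ->
  ultra_coef lambda n != 0.
Proof.
move=> l2 l0; rewrite mulf_neq0 //.
apply/prodf_neq0 => -[[|i] ltin] _ /=; first by rewrite addr0.
by rewrite gt_eqF // -natr1; have : 0 <= i%:R :> R by []; lra.
Qed.

Lemma ultra_coef1 lambda : ultra_coef lambda 1 = lambda.
Proof. by rewrite /ultra_coef pochhammerS pochhammer0 addr0 mul1r divr1. Qed.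

Lemma eq1_succ F (G : nat -> R) : F 0%N = G 0%N ->
  (F =1 G) <-> (forall n, F n.+1 = G n.+1).
Proof. by move=> FG0; split=> [FG n|FG [|n]]. Qed.

Section Equivalences.
Variables (alpha c : R) (F : nat -> R).
Hypotheses (alpha_gt0 : 0 < alpha) (F0 : F 0%N = 1) (F1 : F 1%N = c).
Hypothesis c_neq0 : c != 0.

Let sqrt_ratio k b : 0 < k -> 0 < b ->
  Num.sqrt (b / (k * alpha)) != 0 /\
  alpha * Num.sqrt (b / (k * alpha)) ^+ 2 = b / k.
Proof.
move=> k0 b0; have ka : 0 < b / (k * alpha) by rewrite divr_gt0 // mulr_gt0.
split; first by rewrite gt_eqF // sqrtr_gt0.
by rewrite sqr_sqrtr ?ltW //; field; rewrite !gt_eqF.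
Qed.

Lemma rescaled_ultrasphericalP lambda b :
  - 2^-1 < lambda -> lambda != 0 -> 0 < b ->
  rescaled_ultraspherical alpha lambda b (genP alpha F) <->
  forall n, F n.+1 = c / (b * lambda) * (b ^+ n.+1 * ultra_coef lambda n.+1).
Proof.
move=> l2 l0 b0; have [s0 sE] := sqrt_ratio (ltr0n R 4) b0.
rewrite -{2}(ultra_coef1 lambda) -F1.
rewrite /rescaled_ultraspherical /gegenbauer taylor0_ultraE.
have alpha0 := lt0r_neq0 alpha_gt0; have b0' := lt0r_neq0 b0.
apply: genP_eq_monic_multiple; rewrite ?F1 ?pnatr_eq0 //.
  by move=> n; exact: ultra_coef_neq0.
by rewrite exprMn mulrCA sE; field.
Qed.

Lemma rescaled_chebyshevT_coefP b : 0 < b ->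
  rescaled_chebyshevT alpha b (genP alpha F) <->
  forall n, F n.+1 = c / b * (b ^+ n.+1 * n.+1%:R^-1).
Proof.
move=> b0; have [s0 sE] := sqrt_ratio (ltr0n R 4) b0.
rewrite rescaled_chebyshevTP.
have -> : c / b = F 1%N / (b * cheb_coef R 1) by rewrite F1 /= invr1 mulr1.
have alpha0 := lt0r_neq0 alpha_gt0; have b0' := lt0r_neq0 b0.
apply: (@genP_eq_monic_multiple R F (@cheb_coef R)); rewrite ?F1 ?pnatr_eq0 //.
  exact: cheb_coef_neq0.
by rewrite exprMn mulrCA sE; field.
Qed.

Lemma rescaled_hermiteP a : 0 < a ->
  rescaled_hermite alpha a (genP alpha F) <->
  forall n, F n.+1 = c / a * (a ^+ n.+1 * n.+1`!%:R^-1).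
Proof.
move=> a0; have [s0 sE] := sqrt_ratio (ltr0n R 2) a0.
have -> : c / a = F 1%N / (a * 1`!%:R^-1) by rewrite F1 invr1 mulr1.
have -> : rescaled_hermite alpha a (genP alpha F) <->
   forall n, genP alpha F n = Some (monic_multiple
     (coef_subst (fun n => n`!%:R^-1) (xz_sub_zz 1 2^-1) n
        \Po (Num.sqrt (a / (2 * alpha)) *: 'X))).
  have hE n : monic_multiple (hermite R n \Po
      (Num.sqrt (a / (2 * alpha)) *: 'X)) = monic_multiple
     (coef_subst (fun n => n`!%:R^-1) (xz_sub_zz 1 2^-1) n
        \Po (Num.sqrt (a / (2 * alpha)) *: 'X)).
    by rewrite /hermite taylor0_expRE comp_polyZ monic_multipleZ.
  by split=> h n; rewrite h hE.
have alpha0 := lt0r_neq0 alpha_gt0; have a0' := lt0r_neq0 a0.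
apply: (@genP_eq_monic_multiple R F (fun n => n`!%:R^-1)); rewrite ?F1 ?pnatr_eq0 //.
by rewrite mul1r sE mulrC.
Qed.

Lemma eq_taylor0_ultraspherical lambda b : lambda != 0 -> 0 < b ->
  F =1 taylor0 (F_ultraspherical c lambda b) <->
  forall n, F n.+1 = c / (b * lambda) * (b ^+ n.+1 * ultra_coef lambda n.+1).
Proof.
move=> l0 b0; rewrite eq1_succ; last first.
  by rewrite F0 taylor0_0 /F_ultraspherical mulr0 subr0 powR1 divr1 subrr mulr0 addr0.
have TE n : taylor0 (F_ultraspherical c lambda b) n.+1 =
    c / (b * lambda) * (b ^+ n.+1 * ultra_coef lambda n.+1).
  rewrite mulrA (mulrC b lambda).
  apply: (@taylor0_ultra_der _ (1 - c / (lambda * b))) => z.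
  by rewrite /F_ultraspherical; ring.
by split=> h n; rewrite h TE.
Qed.

Lemma eq_taylor0_chebyshevT b : 0 < b ->
  F =1 taylor0 (F_chebyshevT c b) <->
  forall n, F n.+1 = c / b * (b ^+ n.+1 * n.+1%:R^-1).
Proof.
move=> b0; rewrite eq1_succ; last first.
  by rewrite F0 taylor0_0 /F_chebyshevT mulr0 subr0 divr1 ln1 mulr0 addr0.
have TE n : taylor0 (F_chebyshevT c b) n.+1 = c / b * (b ^+ n.+1 * n.+1%:R^-1).
  by rewrite mulrA; exact: (@taylor0_log_der 1).
by split=> h n; rewrite h TE.
Qed.

Lemma eq_taylor0_hermite a : 0 < a ->
  F =1 taylor0 (F_hermite c a) <->
  forall n, F n.+1 = c / a * (a ^+ n.+1 * n.+1`!%:R^-1).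
Proof.
move=> a0; rewrite eq1_succ; last first.
  by rewrite F0 taylor0_0 /F_hermite mulr0 expR0 subrr mulr0 addr0.
have TE n : taylor0 (F_hermite c a) n.+1 = c / a * (a ^+ n.+1 * n.+1`!%:R^-1).
  rewrite mulrA; apply: (@taylor0_expR (1 - c / a)) => z.
  by rewrite /F_hermite; ring.
by split=> h n; rewrite h TE.
Qed.

End Equivalences.

Lemma F_ultraspherical_standard lambda : lambda != 0 ->
  F_ultraspherical lambda lambda 1 = (fun z : R => 1 / (1 - z) `^ lambda).
Proof.
move=> l0; apply/funext => z; rewrite /F_ultraspherical (mul1r z) mulr1.
by rewrite divff // [X in 1 + X]mul1r addrC subrK.
Qed.

Lemma F_chebyshevT_standard :
  F_chebyshevT 1 1 = (fun z : R => 1 + ln (1 / (1 - z))).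
Proof.
by apply/funext => z; rewrite /F_chebyshevT divr1 (mul1r z) [X in 1 + X]mul1r.
Qed.

Lemma F_hermite_standard : F_hermite 1 1 = @expR R.
Proof.
by apply/funext => z; rewrite /F_hermite divr1 !mul1r addrC subrK.
Qed.

End ClassicalSeries.

(** * Orthogonality forces an affine coefficient ratio *)

Section OrthogonalFunctional.
Variables (R : realType) (L : {poly R} -> R).
Implicit Types p q : {poly R}.
Hypothesis L_linear : forall a (p q : {poly R}), L (a *: p + q) = a * L p + L q.
Hypothesis L_gt0 : forall p : {poly R}, p != 0 -> 0 < L (p * p).

Lemma functional0 : L 0 = 0.
Proof. by have := L_linear (-1) 0 0; rewrite scaler0 add0r; lra. Qed.

Lemma functionalD p q : L (p + q) = L p + L q.
Proof. by have := L_linear 1 p q; rewrite scale1r mul1r. Qed.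

Lemma functionalZ a p : L (a *: p) = a * L p.
Proof. by have := L_linear a p 0; rewrite functional0 !addr0. Qed.

Lemma functionalB p q : L (p - q) = L p - L q.
Proof. by rewrite functionalD -scaleN1r functionalZ mulN1r. Qed.

Variable P : nat -> {poly R}.
Hypothesis sizeP : forall n, size (P n) = n.+1.
Hypothesis orthP : forall m n, m <> n -> L (P m * P n) = 0.

(** P_0, ..., P_(n-1) span the polynomials of degree less than n: subtract from q
    the multiple of P_k that cancels its leading term. *)
Lemma orthogonal_lower_degree n q : (size q <= n)%N -> L (q * P n) = 0.
Proof.
elim: {q}(size q) {-2}q (leqnn (size q)) => [|k IHk] q size_q lt_qn.
  by rewrite (size_poly_leq0P _ size_q) mul0r functional0.
have [eq_qk|] := eqVneq (size q) k.+1; last first.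
  by move=> neq_qk; apply: IHk => //; move: size_q; rewrite leq_eqVlt (negbTE neq_qk).
have lcPk : lead_coef (P k) != 0 by rewrite lead_coef_eq0 -size_poly_eq0 sizeP.
pose a := lead_coef q / lead_coef (P k).
have size_r : (size (q - a *: P k)%R <= k)%N.
  apply/leq_sizeP => j; rewrite leq_eqVlt => /orP[/eqP <-|lt_kj].
    rewrite coefB coefZ; have := lead_coefE q; rewrite eq_qk /= => <-.
    have := lead_coefE (P k); rewrite sizeP /= => <-.
    by rewrite divfK // subrr.
  by rewrite coefB coefZ !nth_default ?mulr0 ?subrr ?sizeP ?eq_qk.
have -> : q = a *: P k + (q - a *: P k) by rewrite addrC subrK.
rewrite mulrDl -scalerAl L_linear orthP ?mulr0 ?add0r; last first.
  by move=> ekn; move: lt_qn; rewrite eq_qk ekn ltnn.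
by apply: IHk => //; rewrite (leq_trans size_r) // ltnW // -eq_qk.
Qed.

Hypothesis monicP : forall n, P n \is monic.
Hypothesis parityP : forall n m, odd (n - m) -> (P n)`_m = 0.

Let lead_P n : (P n)`_n = 1.
Proof. by have := monicP n; rewrite monicE lead_coefE sizeP => /eqP. Qed.

(** D = P_(n+2) - x P_(n+1) + omega P_n, with omega chosen to cancel the
    coefficient of x^n, has degree less than n: its terms in x^(n+2) and x^(n+1)
    vanish because the P_n are monic and have a parity.  It is
    orthogonal to all polynomials of such degree, hence to itself, so D = 0.
    Pairing with P_n gives omega = L(P_(n+1)^2) / L(P_n^2) > 0. *)
Lemma three_term n : exists2 omega : R, 0 < omega &
  P n.+2 = 'X * P n.+1 - omega *: P n.
Proof.
pose omega := ('X * P n.+1 - P n.+2)`_n.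
pose D := P n.+2 - 'X * P n.+1 + omega *: P n.
have size_D : (size D <= n)%N.
  apply/leq_sizeP => j le_nj; rewrite coefD coefB coefZ.
  have [->|neq_jn] := eqVneq j n.
    by rewrite lead_P mulr1 /omega coefB addrC subrKA subrr.
  have lt_nj : (n < j)%N by rewrite ltn_neqAle eq_sym neq_jn.
  rewrite (_ : (P n)`_j = 0) ?mulr0 ?addr0; last first.
    by rewrite nth_default // sizeP.
  case: j lt_nj {le_nj neq_jn} => // j lt_nj; rewrite coefXM /=.
  have [->|neq_j1] := eqVneq j n.+1; first by rewrite !lead_P subrr.
  have [->|neq_j0] := eqVneq j n.
    by rewrite !parityP ?subrr // subSnn.
  by rewrite !nth_default ?subrr ?sizeP //; lia.
have D0 : D = 0.
  apply/eqP/negPn/negP => /L_gt0.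
  have -> : D * D = D * P n.+2 - ('X * D) * P n.+1 + omega *: (D * P n).
    by rewrite {2}/D -!mul_polyC; ring.
  rewrite functionalD functionalB functionalZ !orthogonal_lower_degree //.
  - by rewrite subrr mulr0 addr0 ltxx.
  - rewrite (leq_trans (size_polyMleq _ _)) // size_polyX; exact: size_D.
  - by rewrite (leq_trans size_D) // -addn2 leq_addr.
have recP : P n.+2 = 'X * P n.+1 - omega *: P n.
  by apply/eqP; rewrite -subr_eq0 -D0 /D opprB addrA addrAC.
exists omega => //.
have P_neq0 m : P m != 0 by rewrite -size_poly_eq0 sizeP.
have e1 : L ('X * P n.+1 * P n) = omega * L (P n * P n).
  have : L (P n.+2 * P n) = 0 by apply: orthP; lia.
  rewrite recP mulrBl functionalB -scalerAl functionalZ => /eqP.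
  by rewrite subr_eq0 => /eqP.
have e2 : L ('X * P n.+1 * P n) = L (P n.+1 * P n.+1).
  apply/eqP; rewrite -subr_eq0 -functionalB.
  have -> : 'X * P n.+1 * P n - P n.+1 * P n.+1 =
            ('X * P n - P n.+1) * P n.+1 by ring.
  apply/eqP/orthogonal_lower_degree/leq_sizeP => -[//|j] le_nj.
  rewrite coefB coefXM /=; have [->|neq_jn] := eqVneq j n.
    by rewrite !lead_P subrr.
  by rewrite !nth_default ?subrr ?sizeP //; lia.
rewrite -(pmulr_lgt0 _ (L_gt0 (P_neq0 n))) -e1 e2; exact: L_gt0.
Qed.

End OrthogonalFunctional.


Section RatioOfCoefficients.
Variable R : realType.
Implicit Types (F : nat -> R) (alpha : R).

Lemma coef_monic_subst alpha F n j : F n != 0 -> (j.*2 <= n)%N ->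
  (monic_multiple (coef_subst F (xz_sub_zz 1 alpha) n))`_(n - j.*2) =
  F (n - j)%N / F n * 'C(n - j, j)%:R * (- alpha) ^+ j.
Proof.
move=> Fn le_jn; rewrite monic_multiple_coef_subst ?oner_eq0 // coefZ.
by rewrite coef_coef_substB // !expr1n !mulr1; ring.
Qed.

Lemma bin2R n : 'C(n, 2)%:R = n%:R * (n%:R - 1) / 2 :> R.
Proof.
elim: n => [|n IHn]; first by rewrite mul0r mul0r.
by rewrite binS bin1 natrD IHn -natr1; field.
Qed.

Lemma second_difference0 (t : nat -> R) :
  (forall n, t n.+2 - 2 * t n.+1 + t n = 0) ->
  forall n, t n = t 0%N + n%:R * (t 1%N - t 0%N).
Proof.
move=> tD n; suff [] : t n = t 0%N + n%:R * (t 1%N - t 0%N) /\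
  t n.+1 = t 0%N + n.+1%:R * (t 1%N - t 0%N) by [].
elim: n => [|n [IH1 IH2]]; first by split; ring.
split=> //; have -> : t n.+2 = 2 * t n.+1 - t n by have := tD n; lra.
by rewrite IH1 IH2; ring.
Qed.

(** Archimedean property: a line with negative slope becomes negative. *)
Lemma affine_gt0_slope (x y : R) : (forall n : nat, 0 < x + n%:R * y) -> 0 <= y.
Proof.
move=> xy; rewrite leNgt; apply/negP => y0.
have := xy (Num.truncn (x / - y)).+1.
have : x / - y < (Num.truncn (x / - y)).+1%:R by exact: truncnS_gt.
by rewrite ltr_pdivrMr ?oppr_gt0 // mulrN; lra.
Qed.

(** With t_n = (n + 2) F_(n+2) / F_(n+1), the coefficient of x^n gives
    omega_n = alpha ((n+1)(n+2) / t_n - n (n+1) / t_(n-1)), and the coefficient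
    of x^(n-2) then says that the second differences of t vanish.  Positivity of
    omega_0 is t_0 > 0; positivity of omega_1, omega_2, ... propagates t_n > 0 and
    gives (n+1) t_(n+1) < (n+3) t_n, of which the case n = 0 is 2 A + 3 B > 0;
    since the affine sequence t stays positive, B >= 0. *)
Lemma coef_ratio_affine alpha F : 0 < alpha -> (forall n, F n != 0) ->
  (forall n, exists2 omega : R, 0 < omega &
     let P n := monic_multiple (coef_subst F (xz_sub_zz 1 alpha) n) in
     P n.+2 = 'X * P n.+1 - omega *: P n) ->
  exists A B : R, [/\ 0 <= B, 0 < 2 * A + 3 * B &
    forall n, n.+2%:R * F n.+2 = (A + B * n.+2%:R) * F n.+1].
Proof.
move=> alpha0 F0 rec.
have alpha_neq0 := lt0r_neq0 alpha0.
have omegaE n omega : monic_multiple (coef_subst F (xz_sub_zz 1 alpha) n.+2) =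
     'X * monic_multiple (coef_subst F (xz_sub_zz 1 alpha) n.+1)
     - omega *: monic_multiple (coef_subst F (xz_sub_zz 1 alpha) n) ->
  omega = alpha * (n.+1%:R * (F n.+1 / F n.+2) - n%:R * (F n / F n.+1)).
  move=> /(congr1 (fun P : {poly R} => P`_n)); rewrite coefB coefXM (coefZ omega).
  have := @coef_monic_subst alpha F n 0 (F0 n) isT.
  rewrite double0 !subn0 bin0 expr0 !mulr1 divff // => ->.
  have := @coef_monic_subst alpha F n.+2 1 (F0 _) isT.
  rewrite !subSS !subn0 bin1 expr1 => ->.
  move=> /eqP; rewrite -subr_eq0 => /eqP e; apply/eqP.
  rewrite -subr_eq0 -[X in _ == X]e; apply/eqP.
  case: n {e} => [|n] /=; first by ring.
  have := @coef_monic_subst alpha F n.+2 1 (F0 _) isT.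
  by rewrite !subSS !subn0 bin1 expr1 => ->; ring.
pose t n := n.+2%:R * (F n.+2 / F n.+1).
have F2 n : F n.+2 = t n * F n.+1 / n.+2%:R.
  by rewrite /t; field; rewrite -!natrD !pnatr_eq0 !F0.
have t_neq0 n : t n != 0 by rewrite !mulf_neq0 ?invr_neq0.
have rE n : F n.+1 / F n.+2 = n.+2%:R / t n.
  by rewrite /t; field; rewrite -!natrD !pnatr_eq0 !F0.
have tD n : t n.+2 - 2 * t n.+1 + t n = 0.
  have [omega _ recn] := rec n.+2; have /omegaE omE := recn.
  move: recn => /(congr1 (fun P : {poly R} => P`_n)); rewrite coefB coefXM (coefZ omega).
  have := @coef_monic_subst alpha F n.+4 2 (F0 _) isT.
  rewrite !subSS !subn0 bin2R => ->.
  have := @coef_monic_subst alpha F n.+2 1 (F0 _) isT.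
  rewrite !subSS !subn0 bin1 expr1 => ->.
  have -> : (if n == 0%N then 0 else
     (monic_multiple (coef_subst F (xz_sub_zz 1 alpha) n.+3))`_n.-1) =
     F n.+1 / F n.+3 * (n.+1%:R * n%:R / 2) * alpha ^+ 2.
    case: n {omE} => [|n] /=; first by rewrite mulr0 mul0r mulr0 mul0r.
    have := @coef_monic_subst alpha F n.+4 2 (F0 _) isT.
    rewrite !subSS !subn0 bin2R => ->.
    by rewrite sqrrN -(natr1 n.+1) addrK.
  move: omE => /= omE; rewrite omE {omE}.
  have -> : F n.+2 / F n.+4 = F n.+2 / F n.+3 * (F n.+3 / F n.+4).
    by rewrite mulrA divfK.
  have -> : F n.+1 / F n.+3 = F n.+1 / F n.+2 * (F n.+2 / F n.+3).
    by rewrite mulrA divfK.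
  rewrite !rE => e.
  (* clearing denominators in e exhibits the second difference as a factor *)
  have -> : t n.+2 - 2 * t n.+1 + t n =
    (n.+3%:R / t n.+1 * (n.+4%:R / t n.+2) * (n.+2%:R * (n.+2%:R - 1) / 2)
        * (- alpha) ^+ 2 -
     (n.+2%:R / t n * (n.+3%:R / t n.+1) * (n.+1%:R * n%:R / 2) * alpha ^+ 2 -
      alpha * (n.+3%:R * (n.+4%:R / t n.+2) - n.+2%:R * (n.+3%:R / t n.+1)) *
      (n.+2%:R / t n * n.+1%:R * - alpha))) *
    (2 * t n * t n.+1 * t n.+2 / (alpha ^+ 2 * n.+1%:R * n.+2%:R * n.+3%:R * n.+4%:R)).
    field.
    by rewrite !t_neq0 alpha_neq0 nat1r -!natrD !pnatr_eq0.
  by rewrite e subrr mul0r.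
have t_gt0 : 0 < t 0%N.
  have [omega omega0 /omegaE omE] := rec 0%N; move: omega0.
  by rewrite omE mul0r subr0 mul1r rE pmulr_rgt0 // pmulr_rgt0 // invr_gt0.
have step n : 0 < t n -> 0 < t n.+1 /\ n.+1%:R * t n.+1 < n.+3%:R * t n.
  move=> tn; have [omega omega0 /omegaE omE] := rec n.+1; move: omega0.
  rewrite omE !rE pmulr_rgt0 // subr_gt0 => lt_t.
  have tn1 : 0 < t n.+1.
    rewrite -invr_gt0 -(pmulr_rgt0 _ (ltr0Sn R n.+2)) -(pmulr_rgt0 _ (ltr0Sn R n.+1)).
    by apply: le_lt_trans lt_t; rewrite !mulr_ge0 // invr_ge0 ltW.
  split=> //; rewrite -subr_gt0.
  have -> : n.+3%:R * t n - n.+1%:R * t n.+1 =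
    (n.+2%:R * (n.+3%:R / t n.+1) - n.+1%:R * (n.+2%:R / t n)) *
    (t n * t n.+1 / n.+2%:R).
    by field; rewrite !t_neq0 -natrD pnatr_eq0.
  by rewrite mulr_gt0 ?subr_gt0 // divr_gt0 // mulr_gt0.
have t_gt0n n : 0 < t n by elim: n => // n /step[].
have tE := second_difference0 tD.
pose B := t 1%N - t 0%N; exists (t 0%N - 2 * B), B; split.
- by apply: (@affine_gt0_slope (t 0%N)) => n; rewrite -tE.
- have [_] := step 0%N t_gt0; rewrite /B; lra.
- move=> n; rewrite {1}F2 mulrC divfK ?pnatr_eq0 // tE -/B; ring.
Qed.

End RatioOfCoefficients.

(** * The differential equation and its orthogonality *)

Section DifferentialEquation.
Variable R : realType.
Implicit Types (F G : nat -> R) (A B alpha lambda a b : R).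

(** The relation k F_k = (A + B k) F_(k-1) starts at k = 2, so that F_1 stays free;
    it carries the parameter c. *)
Definition coef_recurrence A B F :=
  forall n, n.+2%:R * F n.+2 = (A + B * n.+2%:R) * F n.+1.

Lemma coef_recurrenceZ A B k F :
  coef_recurrence A B F -> coef_recurrence A B (fun n => k * F n).
Proof. by move=> rF n; rewrite mulrCA rF mulrCA. Qed.

Lemma coef_recurrence_unique A B F G : coef_recurrence A B F ->
  coef_recurrence A B G -> F 1%N = G 1%N -> forall n, F n.+1 = G n.+1.
Proof.
move=> rF rG FG1; elim=> // n IHn.
have n2 : n.+2%:R != 0 :> R by rewrite pnatr_eq0.
by apply: (mulfI n2); rewrite rF rG IHn.
Qed.

Lemma coef_recurrence_eq A B F G : (forall n, F n.+1 = G n.+1) ->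
  coef_recurrence A B G -> coef_recurrence A B F.
Proof. by move=> FG rG n; rewrite !FG. Qed.

Lemma coef_recurrence_ultra lambda b :
  coef_recurrence (b * (lambda - 1)) b (fun n => b ^+ n * ultra_coef lambda n).
Proof.
move=> n; rewrite /ultra_coef (pochhammerS _ n.+1) factS natrM (exprS b n.+1).
by field; rewrite ?nat1r -?natrD ?pnatr_eq0 -?lt0n ?fact_gt0.
Qed.

Lemma coef_recurrence_log b :
  coef_recurrence (- b) b (fun n => b ^+ n * n%:R^-1).
Proof.
move=> n; rewrite (exprS b n.+1).
by field; rewrite ?nat1r -?natrD ?pnatr_eq0 -?lt0n ?fact_gt0.
Qed.

Lemma coef_recurrence_exp a :
  coef_recurrence a 0 (fun n => a ^+ n * n`!%:R^-1).
Proof.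
move=> n; rewrite (exprS a n.+1) (factS n.+1) natrM.
by field; rewrite ?nat1r -?natrD ?pnatr_eq0 -?lt0n ?fact_gt0.
Qed.

Lemma bin_descent n j : (j.+1.*2 <= n)%N ->
  (n - j.*2)%:R * (n - j.*2 - 1)%:R * 'C(n - j, j)%:R =
  j.+1%:R * (n - j)%:R * 'C(n - j.+1, j.+1)%:R :> R.
Proof.
move=> le_jn; rewrite -!natrM; congr _%:R.
have [k ->] : {k | n = (k + j.+1.*2)%N} by exists (n - j.+1.*2)%N; lia.
have -> : (k + j.+1.*2 - j.*2 = k.+2)%N by lia.
have -> : (k + j.+1.*2 - j = (k + j).+2)%N by lia.
have -> : (k + j.+1.*2 - j.+1 = (k + j).+1)%N by lia.
have e1 := mul_bin_left (k + j).+1 j; have e2 := mul_bin_down (k + j).+1 j.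
have e3 := mul_bin_down (k + j).+2 j; rewrite /= in e2 e3.
have k1 : ((k + j).+1 - j = k.+1)%N by lia.
have k2 : ((k + j).+2 - j = k.+2)%N by lia.
rewrite k1 in e1; rewrite k2 in e3.
by rewrite subn1 /= mulnAC -e3 [in RHS]mulnAC e1; ring.
Qed.

(** The differential equation on coefficients.  For m = n - 2 (j + 1) the two
    coefficients involve F_(n-j) and F_(n-j-1), which [coef_recurrence] relates. *)
Lemma coef_monic_step alpha A B F n m : (forall n, F n != 0) ->
  coef_recurrence A B F ->
  let y := monic_multiple (coef_subst F (xz_sub_zz 1 alpha) n) in
  4 * alpha * (m.+2%:R * m.+1%:R) * y`_m.+2 =
  - ((n%:R - m%:R) * (B * (n%:R + m%:R - 1) + (2 * A + 3 * B))) * y`_m.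
Proof.
move=> F_neq0 rF y; have size_y : size y = n.+1.
  rewrite /y monic_multiple_coef_subst ?oner_eq0 // size_scale.
    by rewrite size_coef_subst ?oner_eq0.
  by rewrite invr_neq0 // expr1n mulr1.
have [lt_nm|le_mn] := ltnP n m.
  by rewrite !nth_default ?size_y ?mulr0 //; lia.
have [->|neq_mn] := eqVneq m n.
  by rewrite subrr !mul0r oppr0 mul0r nth_default ?mulr0 ?size_y.
have [odd_nm|even_nm] := boolP (odd (n - m)).
  rewrite /y monic_multiple_coef_subst ?oner_eq0 // !coefZ !coef_coef_subst.
  rewrite odd_nm andbF !mulr0; case: ifP => [/andP[le_m2n even_nm2]|_].
    by exfalso; lia.
  by rewrite !mulr0.
have [j nE] : {j | n = (m + j.+1.*2)%N} by exists (n - m)./2.-1; lia.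
have le_jn : (j.+1.*2 <= n)%N by rewrite nE leq_addl.
have mE : m = (n - j.+1.*2)%N by rewrite nE addnK.
have m2E : m.+2 = (n - j.*2)%N by rewrite nE; lia.
have le_jn' : (j.*2 <= n)%N by lia.
have binE := bin_descent le_jn.
have [k kE] : {k | n - j = k.+2}%N by exists (n - j).-2; lia.
have kE' : (n - j.+1 = k.+1)%N by lia.
have Fk : k.+2%:R * F k.+2 = (A + B * k.+2%:R) * F k.+1 by exact: rF.
rewrite -m2E subn1 /= kE kE' in binE.
have -> : y`_m.+2 = F k.+2 / F n * 'C(k.+2, j)%:R * (- alpha) ^+ j.
  by rewrite m2E coef_monic_subst // kE.
have -> : y`_m = F k.+1 / F n * 'C(k.+1, j.+1)%:R * (- alpha) ^+ j.+1.
  by rewrite mE coef_monic_subst // kE'.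
have nR : n%:R = k.+2%:R + j%:R :> R by rewrite -natrD; congr _%:R; lia.
have mR : m%:R = k.+2%:R + j%:R - 2 * j.+1%:R :> R.
  by rewrite -nR nE -muln2 natrD natrM; ring.
transitivity (4 * alpha * (m.+2%:R * m.+1%:R * 'C(k.+2, j)%:R) * F k.+2 / F n * (- alpha) ^+ j).
  by ring.
rewrite binE.
transitivity (4 * alpha * j.+1%:R * 'C(k.+1, j.+1)%:R * (k.+2%:R * F k.+2) / F n * (- alpha) ^+ j).
  by ring.
by rewrite Fk nR mR exprS; ring.
Qed.

Lemma monic_ode alpha A B F n : (forall n, F n != 0) -> coef_recurrence A B F ->
  let y := monic_multiple (coef_subst F (xz_sub_zz 1 alpha) n) in
  ((4 * alpha)%:P - B *: 'X^2) * y^`()^`() - (2 * A + 3 * B) *: ('X * y^`())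
  + (n%:R * (B * (n%:R - 1) + (2 * A + 3 * B))) *: y = 0.
Proof.
move=> F_neq0 rF y; apply/polyP => m; rewrite coef0.
have step := @coef_monic_step alpha A B F n m F_neq0 rF; rewrite /= -/y in step.
have X0 k : (y^`()^`())`_k = k.+1%:R * (k.+2%:R * y`_k.+2).
  by rewrite !coef_deriv -(mulr_natl y`_k.+2) -(mulr_natl (_ * y`_k.+2)).
have X2 : ('X^2 * y^`()^`())`_m = m%:R * (m%:R - 1) * y`_m.
  rewrite coefXnM; case: m {step} => [|[|m]] /=; rewrite ?mul0r //.
    by rewrite subrr mulr0 mul0r.
  by rewrite !subSS subn0 X0; ring.
have X1 : ('X * y^`())`_m = m%:R * y`_m.
  by rewrite coefXM; case: m {step X2} => [|m] /=; rewrite ?mul0r // coef_deriv mulr_natl.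
clearbody y; rewrite coefD coefB mulrBl coefB coefCM -(scalerAl B) !coefZ X0 X2 X1.
have -> : 4 * alpha * (m.+1%:R * (m.+2%:R * y`_m.+2)) =
  4 * alpha * (m.+2%:R * m.+1%:R) * y`_m.+2 by ring.
by rewrite step; ring.
Qed.

(** Applying the Pearson identity to q P_n' shows that the differential operator is
    symmetric, e_n L(q P_n) = L((4 alpha - B x^2) q' P_n').  Since
    e_n - e_m = (n - m) (B (n + m - 1) + 2 A + 3 B), the eigenvalues are distinct. *)
Lemma ode_orthogonal alpha A B (L : {poly R} -> R) (P : nat -> {poly R}) :
  0 <= B -> 0 < 2 * A + 3 * B ->
  (forall a (p q : {poly R}), L (a *: p + q) = a * L p + L q) ->
  (forall p : {poly R}, L (((4 * alpha)%:P - B *: 'X^2) * p^`()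
                           - (2 * A + 3 * B) *: ('X * p)) = 0) ->
  (forall n, ((4 * alpha)%:P - B *: 'X^2) * (P n)^`()^`()
     - (2 * A + 3 * B) *: ('X * (P n)^`())
     + (n%:R * (B * (n%:R - 1) + (2 * A + 3 * B))) *: P n = 0) ->
  forall m n, m <> n -> L (P m * P n) = 0.
Proof.
move=> B0 AB0 Llin Lpearson ode.
set w := 2 * A + 3 * B in AB0 Lpearson ode *.
set Q : {poly R} := _ - _ in Lpearson ode.
pose e n : R := n%:R * (B * (n%:R - 1) + w).
have selfadjoint (q : {poly R}) n : e n * L (q * P n) = L (Q * q^`() * (P n)^`()).
  have -> : Q * q^`() * (P n)^`() =
    (Q * (q * (P n)^`())^`() - w *: ('X * (q * (P n)^`())))
     + (e n *: (q * P n)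
     - q * (Q * (P n)^`()^`() - w *: ('X * (P n)^`()) + e n *: P n)).
    by rewrite derivM -!mul_polyC; ring.
  rewrite ode mulr0 subr0 addrC Llin Lpearson addr0 //.
move=> m n neq_mn.
have eq_mn : e n * L (P m * P n) = e m * L (P m * P n).
  rewrite selfadjoint [P m * P n]mulrC selfadjoint; congr L; ring.
have : (e n - e m) * L (P m * P n) = 0 by rewrite mulrBl eq_mn subrr.
have -> : e n - e m = (n%:R - m%:R) * (B * (n%:R + m%:R - 1) + w).
  by rewrite /e; ring.
move/eqP; rewrite !mulf_eq0 => /orP[/orP[]|/eqP//].
  by rewrite subr_eq0 eqr_nat => /eqP nm; case: neq_mn.
have nm1 : 1 <= n%:R + m%:R :> R by rewrite -natrD ler1n; lia.
rewrite gt_eqF // ltr_wpDl // mulr_ge0 // subr_ge0 //.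
Qed.

End DifferentialEquation.

(** * Integrals of polynomials *)

Section MeasureFunctional.
Local Open Scope classical_set_scope.
Variables (R : realType) (mu : {measure set (measurableTypeR R) -> \bar R}).
Implicit Types p q : {poly R}.
Hypothesis moments : forall k : nat, mu.-integrable setT (fun x : R => (x ^+ k)%:E).

Lemma measurable_horner p : measurable_fun setT (fun x : R => p.[x]).
Proof. by apply: continuous_measurable_fun; exact: continuous_horner. Qed.

Lemma integrable_poly p : mu.-integrable setT (EFin \o (fun x : R => p.[x])).
Proof.
have -> : EFin \o (fun x : R => p.[x]) =
  (fun x => \sum_(i < size p) ((p`_i)%:E * (x ^+ i)%:E))%E.
  by apply/funext => x /=; rewrite horner_coef -sumEFin.
by apply: integrable_sum => // i _; exact: integrableZl.
Qed.

Definition poly_integral p : R := \int[mu]_x p.[x].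

Lemma EFin_poly_integral p : (poly_integral p)%:E = (\int[mu]_x (p.[x])%:E)%E.
Proof. by rewrite fineK //; apply: integrable_fin_num => //; exact: integrable_poly. Qed.

Lemma poly_integral_linear a p q :
  poly_integral (a *: p + q) = a * poly_integral p + poly_integral q.
Proof.
rewrite /poly_integral -RintegralZl //; last exact: integrable_poly.
rewrite -RintegralD //; [|exact: integrableZl (integrable_poly p)|exact: integrable_poly].
by apply: eq_Rintegral => x _; rewrite hornerD hornerZ.
Qed.

(** If the integral vanished, the open set where p is nonzero would be null, hence
    disjoint from the support, which would lie among the finitely many roots. *)
Lemma poly_integral_sqr_gt0 p : infinite_set (measure_support mu) ->
  p != 0 -> 0 < poly_integral (p * p).
Proof.
move=> supp_inf p0; rewrite lt_neqAle; apply/andP; split; last first.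
  by apply: Rintegral_ge0 => x _; rewrite hornerM -expr2 sqr_ge0.
rewrite eq_sym; apply/eqP => pp0.
have int0 : (\int[mu]_x `|((p * p).[x])%:E| = 0)%E.
  rewrite -[RHS](congr1 EFin pp0) EFin_poly_integral; apply: eq_integral => x _.
  by rewrite gee0_abs // lee_fin hornerM -expr2 sqr_ge0.
have /ae_eq_integral_abs :
    measurable_fun [set: measurableTypeR R] (EFin \o (fun x : R => (p * p).[x])).
  by apply/measurable_EFinP; exact: measurable_horner.
move=> /(_ mu measurableT)[+ _] => /(_ int0) ae0.
pose U := [set x : R | p.[x] != 0].
have openU : open U.
  have -> : U = (horner p) @^-1` (~` [set 0]).
    by apply/seteqP; split => x /=; [move/eqP|move=> /eqP].
  apply: open_comp; first by move=> x _; exact: continuous_horner.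
  by apply: closed_openC; exact: closed_eq.
have muU : mu U = 0%E.
  have [N [mN muN0 subN]] := ae0.
  apply: (subset_measure0 _ mN _ muN0); first exact: open_measurable.
  move=> x Ux; apply: subN => /= /(_ I) [] /eqP.
  by rewrite hornerM mulf_eq0 orbb (negbTE Ux).
have supp_roots : measure_support mu `<=` [set x | root p x].
  move=> x suppx /=; apply/negPn/negP => nroot.
  by have := suppx U openU nroot; rewrite muU ltxx.
have [B subB sizeB] := infinite_set_fset (size p) supp_inf.
have rootsB : all (root p) (finmap.enum_fset B).
  by apply/allP => x xB; apply: supp_roots; exact: subB.
by have := max_poly_roots p0 rootsB (finmap.fset_uniq B); rewrite ltnNge sizeB.
Qed.

End MeasureFunctional.

(** * Measures with a density, image measures and supports *)

Section DensityMeasure.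
Local Open Scope classical_set_scope.
Variable R : realType.
Local Notation leb := (@lebesgue_measure R).

(** The density of the measure agrees almost everywhere with its Radon-Nikodym
    derivative, which reduces integrals against it to Lebesgue integrals. *)
Lemma density_measure (g : R -> R) : (forall x, 0 <= g x) ->
  leb.-integrable setT (EFin \o g) ->
  exists mu : {measure set (measurableTypeR R) -> \bar R},
    (forall A, measurable A -> mu A = (\int[leb]_(x in A) (g x)%:E)%E) /\
    (forall f : R -> R, measurable_fun setT f ->
      leb.-integrable setT (EFin \o (f \* g)) ->
      mu.-integrable setT (EFin \o f) /\
      \int[mu]_x f x = \int[leb]_x (f x * g x)).
Proof.
move=> g0 ig.
have mg : measurable_fun [set: measurableTypeR R] (EFin \o g).
  exact: measurable_int ig.
pose nu (A : set (measurableTypeR R)) := (\int[leb]_(x in A) (g x)%:E)%E.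
have nu0 : nu set0 = 0%E by rewrite /nu integral_set0.
have nu_ge0 A : (0 <= nu A)%E by apply: integral_ge0 => x _; rewrite lee_fin.
have nu_sigma : semi_sigma_additive nu.
  move=> A mA tA mUA; rewrite /nu integral_bigcup //; last first.
    exact: integrableS ig.
  by apply: is_cvg_ereal_nneg_natsum_cond => n _ _; exact: nu_ge0.
pose H1 := isMeasure.Build _ _ _ nu nu0 nu_ge0 nu_sigma.
pose nuM : {measure set (measurableTypeR R) -> \bar R} := HB.pack nu H1.
have nu_fin : fin_num_fun nuM.
  move=> A mA; apply: integrable_fin_num => //; exact: integrableS ig.
pose H2 := Measure_isFinite.Build _ _ _ nuM nu_fin.
pose nuF : {finite_measure set (measurableTypeR R) -> \bar R} := HB.pack nu H1 H2.
exists nuF; split=> //.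
have nu_leb : nuF `<< leb.
  apply/null_content_dominatesP => A mA A0.
  by apply: null_set_integral => //; apply: measurable_funTS.
pose h := Radon_Nikodym_SigmaFinite.f nuF leb.
have h_g : ae_eq leb setT h (EFin \o g).
  apply: integral_ae_eq => //.
    exact: Radon_Nikodym_SigmaFinite.f_integrable.
  by move=> A _ mA; rewrite -Radon_Nikodym_SigmaFinite.f_integral.
have ge0_int (f : R -> R) : measurable_fun [set: measurableTypeR R] f ->
    (forall x, 0 <= f x) ->
    (\int[nuF]_x (f x)%:E = \int[leb]_x (f x * g x)%:E)%E.
  move=> mf f0; have mEf : measurable_fun [set: measurableTypeR R] (EFin \o f).
    exact/measurable_EFinP.
  rewrite -(Radon_Nikodym_SigmaFinite.change_of_variables nu_leb) //.
  apply: ae_eq_integral => //.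
  - apply: emeasurable_funM => //; apply: measurable_int.
    exact: Radon_Nikodym_SigmaFinite.f_integrable.
  - by under eq_fun do rewrite EFinM; exact: emeasurable_funM.
  - apply: filterS h_g => x /= hx _; by rewrite EFinM -/h hx.
move=> f mf ifg.
have mf' : measurable_fun [set: measurableTypeR R] f by [].
have ifnu : nuF.-integrable setT (EFin \o f).
  apply/integrableP; split; first exact/measurable_EFinP.
  have -> : (\int[nuF]_x `|(EFin \o f) x| = \int[nuF]_x (`|f x|)%:E)%E.
    by apply: eq_integral.
  rewrite ge0_int //; last exact: measurableT_comp.
  have [_] := integrableP _ _ _ ifg; congr (_ < _)%E.
  apply: eq_integral => x _.
  by rewrite /= normrM (ger0_norm (g0 x)).
split=> //; rewrite /Rintegral; congr fine.
have pos_part (k : R -> R) : measurable_fun [set: measurableTypeR R] k ->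
    (\int[nuF]_x (EFin \o k)^\+ x = \int[leb]_x (EFin \o (k \* g)%R)^\+ x)%E.
  move=> mk.
  transitivity (\int[nuF]_x (Num.max (k x) 0)%R%:E)%E.
    by apply: eq_integral => x _; rewrite funeposE /= EFin_max.
  rewrite ge0_int.
  - by apply: eq_integral => x _; rewrite funeposE /= -EFin_max maxr_pMl // mul0r.
  - exact: measurable_maxr.
  - by move=> x; rewrite le_max lexx orbT.
rewrite [LHS]integralE [RHS]integralE pos_part //; congr (_ - _)%E.
have negE (k : R -> R) : ((EFin \o k)^\- = (EFin \o (fun x => - k x)%R)^\+)%E.
  by rewrite -funeposN; congr funepos; apply/funext.
rewrite negE pos_part; last by apply: measurableT_comp.
rewrite negE; apply: eq_integral => x _; congr (_ x).
by congr funepos; apply/funext => y /=; rewrite mulNr.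
Qed.

End DensityMeasure.

Lemma image_measure (R : realType) (nu : {measure set (measurableTypeR R) -> \bar R})
    (psi : R -> R) : measurable_fun [set: measurableTypeR R] psi ->
  exists mu : {measure set (measurableTypeR R) -> \bar R},
    (forall A, mu A = nu (psi @^-1` A)%classic) /\
    (forall f : R -> R, measurable_fun setT f ->
      nu.-integrable setT (EFin \o (f \o psi)) ->
      mu.-integrable setT (EFin \o f) /\ \int[mu]_x f x = \int[nu]_t f (psi t)).
Proof.
move=> mpsi.
have mpsi' : measurable_fun [set: measurableTypeR R] (psi : _ -> measurableTypeR R).
  exact: mpsi.
exists (measure_function_pushforward__canonical__measure_function_Measure nu mpsi').
split=> // f mf inu.
have mEf : measurable_fun [set: measurableTypeR R] (EFin \o f).
  exact/measurable_EFinP.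
split; first exact: integrable_pushforward.
by rewrite /Rintegral integral_pushforward.
Qed.

Section Support.
Local Open Scope classical_set_scope.
Variable R : realType.
Local Notation leb := (@lebesgue_measure R).

Lemma density_itv_gt0 (g : R -> R) (a b : R) (A : set R) : a < b ->
  measurable A -> `]a, b[ `<=` A -> (forall x, 0 <= g x) ->
  measurable_fun setT g -> (forall x, a < x < b -> 0 < g x) ->
  (0 < \int[leb]_(x in A) (g x)%:E)%E.
Proof.
move=> ab mA subA g0 mg gpos.
have mEg (D : set R) : measurable D -> measurable_fun D (EFin \o g).
  by move=> mD; apply/measurable_EFinP; exact: measurable_funTS.
apply: (@lt_le_trans _ _ (\int[leb]_(x in `]a, b[) (g x)%:E)%E); last first.
  by apply: ge0_subset_integral => //; [exact: mEg|move=> x _; rewrite lee_fin].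
rewrite lt_neqAle integral_ge0 ?andbT; last by move=> x _; rewrite lee_fin.
apply/eqP => int0.
have [+ _] := @ae_eq_integral_abs _ _ _ leb _ (measurable_itv (Interval (BRight a) (BLeft b))) _
  (mEg _ (measurable_itv (Interval (BRight a) (BLeft b)))).
case=> [|N [mN N0 subN]].
  by rewrite [RHS]int0; apply: eq_integral => x _; rewrite gee0_abs // lee_fin.
have : (leb `]a, b[%classic <= leb N)%E.
  apply: le_measure; rewrite ?inE //; apply: subset_trans subN => x /= xab.
  move=> /(_ xab) /= [gx0]; move: xab; rewrite in_itv /= => /gpos.
  by rewrite gx0 ltxx.
rewrite N0 lebesgue_measure_itv /= lte_fin ab -EFinB lee_fin subr_le0.
by rewrite leNgt ab.
Qed.

(** A countable set is Lebesgue null. *)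
Lemma infinite_itv (a b : R) (A : set R) : a < b -> `]a, b[ `<=` A -> infinite_set A.
Proof.
move=> ab subA /finite_set_countable countA.
have := countable_lebesgue_measure0 (sub_countable (subset_card_le subA) countA).
by rewrite lebesgue_measure_itv /= lte_fin ab => /eqP; rewrite -EFinB eqe subr_eq0 gt_eqF.
Qed.

End Support.

(** * The Gaussian measure *)

Section Gaussian.
Local Open Scope classical_set_scope.
Variable R : realType.
Local Notation leb := (@lebesgue_measure R).
Implicit Types (c d x : R) (p : {poly R}).

Definition gaussian c x : R := expR (- (c * x ^+ 2)).

Lemma gaussian_gt0 c x : 0 < gaussian c x. Proof. exact: expR_gt0. Qed.

Lemma gaussianD c x : gaussian c x = gaussian (c / 2) x * gaussian (c / 2) x.
Proof. by rewrite /gaussian -expRD; congr expR; field. Qed.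

Lemma is_derive_gaussian c x :
  is_derive x 1 (gaussian c) (- (2 * c * x) * gaussian c x).
Proof.
have dq : is_derive x 1 (fun y : R => - (c * y ^+ 2)) (- (2 * c * x)).
  have := is_deriveX 2 (@is_derive_id R R x 1); rewrite exprfctE => dsq.
  apply: is_derive_eq; rewrite /GRing.scale /= mulr1; ring.
have := @is_derive1_comp _ (@expR R) (fun y : R => - (c * y ^+ 2)) x _ _
  (is_derive_expR _) dq.
by rewrite mulrC.
Qed.

Lemma continuous_gaussian c : continuous (gaussian c).
Proof.
move=> x; apply: differentiable_continuous; apply/derivable1_diffP.
by have [] := is_derive_gaussian c x.
Qed.

Lemma measurable_gaussian c : measurable_fun setT (gaussian c).
Proof. by apply: continuous_measurable_fun; exact: continuous_gaussian. Qed.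

Lemma integrable_gaussian c : 0 < c ->
  leb.-integrable setT (EFin \o gaussian c).
Proof.
move=> c0; pose s : R := Num.sqrt (2 * c)^-1.
have s0 : s != 0 by rewrite gt_eqF // sqrtr_gt0 invr_gt0 mulr_gt0.
have -> : EFin \o gaussian c =
   (fun x => ((normal_peak s)^-1)%:E * (normal_pdf 0 s x)%:E)%E.
  apply/funext => x /=; rewrite normal_pdfE // -EFinM mulKf; last first.
    by rewrite gt_eqF // normal_peak_gt0.
  rewrite /gaussian /normal_fun subr0 sqr_sqrtr ?invr_ge0 ?mulr_ge0 ?ltW //.
  congr (expR _)%:E; by rewrite -mulr_natl; field; rewrite gt_eqF.
exact: (integrableZl measurableT _ (integrable_normal_pdf 0 s)).
Qed.

(** With y = c x^2, raise y / k <= exp (y / k) to the k-th power, and use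
    |x|^k <= 1 + x^(2 k). *)
Lemma gaussian_exprn_le c k x : 0 < c ->
  `|x ^+ k| * gaussian c x <= 1 + (k%:R / c) ^+ k.
Proof.
move=> c0; have y0 : 0 <= c * x ^+ 2 by rewrite mulr_ge0 ?sqr_ge0 // ltW.
have g1 : gaussian c x <= 1 by rewrite /gaussian -expR0 ler_expR oppr_le0.
have le_x : `|x ^+ k| <= 1 + (x ^+ 2) ^+ k.
  rewrite exprAC -[(x ^+ k) ^+ 2]real_normK ?num_real //; set z := `|_|.
  have z0 : 0 <= z by exact: normr_ge0.
  by have := sqr_ge0 (z - 1); nra.
apply: (@le_trans _ _ ((1 + (x ^+ 2) ^+ k) * gaussian c x)).
  by rewrite ler_pM2r ?gaussian_gt0.
rewrite mulrDl mul1r lerD //.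
case: k {le_x} => [|k]; first by rewrite !expr0 mul1r.
have k0 : 0 < k.+1%:R :> R by [].
rewrite /gaussian expRN ler_pdivrMr ?expR_gt0 //.
have le_exp : c * x ^+ 2 / k.+1%:R <= expR (c * x ^+ 2 / k.+1%:R).
  by apply: le_trans (expR_ge1Dx _); rewrite lerDr.
have := lerXn2r k.+1 _ _ le_exp; rewrite !nnegrE divr_ge0 // expR_ge0.
move=> /(_ isT isT); rewrite -expRM_natl (mulrC k.+1%:R) divfK ?gt_eqF // => le_exp'.
have -> : (x ^+ 2) ^+ k.+1 = (k.+1%:R / c) ^+ k.+1 * (c * x ^+ 2 / k.+1%:R) ^+ k.+1.
  by rewrite -exprMn; congr (_ ^+ _); field; rewrite !gt_eqF.
by rewrite ler_wpM2l // exprn_ge0 // divr_ge0 // ltW.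
Qed.

Lemma gaussian_poly_bounded c p : 0 < c ->
  exists C : R, forall x, `|p.[x]| * gaussian c x <= C.
Proof.
move=> c0; exists (\sum_(i < size p) `|p`_i| * (1 + (i%:R / c) ^+ i)) => x.
rewrite horner_coef.
apply: (@le_trans _ _ ((\sum_(i < size p) `|p`_i * x ^+ i|) * gaussian c x)).
  by rewrite ler_pM2r ?gaussian_gt0 // ler_norm_sum.
rewrite mulr_suml; apply: ler_sum => i _.
by rewrite normrM -mulrA ler_wpM2l // gaussian_exprn_le.
Qed.

(** One half of the exponent bounds the polynomial, the other half provides
    integrability. *)
Lemma integrable_poly_gaussian c p : 0 < c ->
  leb.-integrable setT (EFin \o (fun x => p.[x] * gaussian c x)).
Proof.
move=> c0; have c20 : 0 < c / 2 by rewrite divr_gt0.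
have [C leC] := gaussian_poly_bounded p c20.
have -> : EFin \o (fun x => p.[x] * gaussian c x) =
  ((EFin \o (fun x : R => (p.[x] * gaussian (c / 2) x)%R)) \*
    (EFin \o gaussian (c / 2)%R))%E.
  by apply/funext => x /=; rewrite -EFinM -mulrA -gaussianD.
apply: integrableMr => //.
- apply: measurable_funM; last exact: measurable_gaussian.
  exact: measurable_horner.
- exists C; split; first exact: num_real.
  move=> M ltCM x _; rewrite /= normrM (gtr0_norm (gaussian_gt0 _ _)).
  exact: le_trans (leC x) (ltW ltCM).
- exact: integrable_gaussian.
Qed.

(** The bound for x p(x) gives decay like C / (n + 1) at points of absolute value
    n + 1. *)
Lemma gaussian_poly_tail c p (u : nat -> R) : 0 < c ->
  (forall n, `|u n| = n.+1%:R) ->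
  p.[u n] * gaussian c (u n) @[n --> \oo] --> 0.
Proof.
move=> c0 uE; have [C leC] := gaussian_poly_bounded ('X * p) c0.
apply/norm_cvg0P.
have Ch : C * harmonic n @[n --> \oo] --> 0.
  by rewrite -[X in _ --> X](mulr0 C); apply: cvgM; [exact: cvg_cst|exact: cvg_harmonic].
apply: (squeeze_cvgr _ (cvg_cst 0) Ch).
apply: nearW => n; rewrite normr_ge0 /= /harmonic ler_pdivlMr //.
have := leC (u n); rewrite hornerM hornerX !normrM uE.
by rewrite (gtr0_norm (gaussian_gt0 _ _)); nra.
Qed.

(** The integrand is the derivative of p(x) exp (- c x^2), which vanishes at
    infinity. *)
Lemma gaussian_pearson c p : 0 < c ->
  \int[leb]_x ((p^`() - (2 * c) *: ('X * p)).[x] * gaussian c x) = 0.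
Proof.
move=> c0; set q := _ - _.
pose f x := q.[x] * gaussian c x; pose G x := p.[x] * gaussian c x.
have if_ : leb.-integrable setT (EFin \o f) by exact: integrable_poly_gaussian.
have dG x : is_derive x 1 G (f x).
  have dp := is_derive_poly p x; have dg := is_derive_gaussian c x.
  have -> : G = horner p * gaussian c by [].
  apply: is_derive_eq; rewrite /GRing.scale /= /f /q !hornerE /=; ring.
have cf : continuous f.
  move=> x; apply: continuousM; [exact: continuous_horner|exact: continuous_gaussian].
have cG : continuous G.
  move=> x; apply: continuousM; [exact: continuous_horner|exact: continuous_gaussian].
pose I n : set R := `[- n.+1%:R, n.+1%:R].
have ftc n : (\int[leb]_x ((EFin \o f) \_ (I n)) x = (G n.+1%:R - G (- n.+1%:R))%:E)%E.
  rewrite -integral_mkcond EFinB; apply: continuous_FTC2.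
  - by rewrite gtrN.
  - exact: continuous_subspaceT.
  - split.
    + by move=> x _; have [] := dG x.
    + exact/cvg_at_right_filter/cG.
    + exact/cvg_at_left_filter/cG.
  - by move=> x _; rewrite derive1E; have [_ ->] := dG x.
have lim0 : (G n.+1%:R - G (- n.+1%:R))%:E @[n --> \oo] --> 0%:E.
  apply: cvg_EFin; first by apply: nearW.
  rewrite -[X in _ --> X](subrr 0); apply: cvgB; apply: gaussian_poly_tail => // n.
    by rewrite ger0_norm.
  by rewrite normrN ger0_norm.
have limI : (\int[leb]_x ((EFin \o f) \_ (I n)) x @[n --> \oo] -->
    \int[leb]_x (f x)%:E)%E.
  have mI n : measurable (I n) by exact: measurable_itv.
  have mf : measurable_fun [set: measurableTypeR R] (EFin \o f).
    exact: measurable_int if_.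
  have [] := @dominated_convergence _ _ R leb setT measurableT
    (fun n => (EFin \o f) \_ (I n)) (EFin \o f) (abse \o (EFin \o f)) => //.
  - move=> n; apply/measurable_restrict => //; first exact: mI.
    by rewrite setTI; exact: measurable_funTS.
  - apply: nearW => x _; apply: cvg_near_cst; near=> n.
    rewrite patchE mem_set // /I /= in_itv /= -ler_norml.
    apply: (@le_trans _ _ n%:R); last by rewrite ler_nat.
    near: n; exact: nbhs_infty_ger.
  - exact: integrable_abse.
  - apply: nearW => x n _; rewrite patchE; case: ifP => _ //=.
    by rewrite normr0 lee_fin.
have e : (fun n => \int[leb]_x ((EFin \o f) \_ (I n)) x)%E =
  (fun n => (G n.+1%:R - G (- n.+1%:R))%:E) by apply/funext.
rewrite e in limI.
have : (\int[leb]_x (f x)%:E = 0%:E)%E by exact: cvg_unique limI lim0.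
by rewrite /Rintegral => ->.
Unshelve. all: by end_near. Qed.

Lemma gaussian_measure (alpha A : R) : 0 < alpha -> 0 < A ->
  exists mu : {measure set (measurableTypeR R) -> \bar R},
  [/\ infinite_set (measure_support mu),
      forall k : nat, mu.-integrable setT (fun x : R => (x ^+ k)%:E) &
      forall p, poly_integral mu (4 * alpha *: p^`() - (2 * A) *: ('X * p)) = 0].
Proof.
move=> alpha0 A0; pose c := A / (4 * alpha).
have c0 : 0 < c by rewrite divr_gt0 // mulr_gt0.
have [mu [muE muf]] := density_measure (fun x => ltW (gaussian_gt0 c x))
  (integrable_gaussian c0).
exists mu; split.
- apply: (@infinite_itv _ 0 1) => // x _ U oU Ux.
  have mU : measurable (U : set (measurableTypeR R)) by exact: open_measurable.
  have /nbhs_ballP[e /= e0 sub] := open_nbhs_nbhs (conj oU Ux).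
  rewrite muE //; apply: (@density_itv_gt0 _ _ (x - e) (x + e)) => //.
  + by rewrite ltrD2l gtrN.
  + by move=> y /=; rewrite in_itv /= => yxe; apply: sub; rewrite /ball /= ltr_distlC.
  + by move=> y; rewrite ltW // gaussian_gt0.
  + exact: measurable_gaussian.
  + by move=> y _; exact: gaussian_gt0.
- move=> k; have [] := muf (fun x => x ^+ k) => //.
  have -> : EFin \o ((fun x => x ^+ k) \* gaussian c) =
     (EFin \o (fun x => ('X^k : {poly R}).[x] * gaussian c x)).
    by apply/funext => x /=; rewrite hornerXn.
  exact: integrable_poly_gaussian.
- move=> p.
  have -> : 4 * alpha *: p^`() - (2 * A) *: ('X * p) =
     (4 * alpha) *: (p^`() - (2 * c) *: ('X * p)).
    rewrite scalerBr scalerA; congr (_ - _ *: _); rewrite /c; field.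
    by rewrite gt_eqF.
  rewrite /poly_integral; set q := _ - _.
  have [_ ->] := muf (fun x => (4 * alpha *: q).[x]) (measurable_horner _)
    (integrable_poly_gaussian _ c0).
  under eq_Rintegral do rewrite hornerZ -mulrA.
  rewrite RintegralZl //; last exact: integrable_poly_gaussian.
  by rewrite gaussian_pearson // mulr0.
Qed.

End Gaussian.

(** * The ultraspherical measure *)

Section Ultraspherical.
Local Open Scope classical_set_scope.
Variables (R : realType) (a : R).
Hypothesis a_gt0 : 0 < a.
Local Notation leb := (@lebesgue_measure R).
Implicit Types (t s : R) (S : {poly R}).

Let theta t : R := t `^ a.

(** With a = 2 / eps and y = 1 - t^a, the weight (1 - y^2)^(eps/2 - 1) dy on [0, 1]
    becomes, up to a constant factor, (1 + y)^(eps/2 - 1) dt. *)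
Definition jacobi_density t : R := (2 - t `^ a) `^ (a^-1 - 1).

Let theta0 : theta 0 = 0.
Proof. by rewrite /theta powR0 // gt_eqF. Qed.

Let theta1 : theta 1 = 1.
Proof. by rewrite /theta powR1. Qed.

Let is_derive_theta t : 0 < t -> is_derive t 1 theta (a * t `^ (a - 1)).
Proof. exact: is_derive1_powR. Qed.

Let theta_lt2 t : t <= 1 -> theta t < 2.
Proof.
move=> t1; have [t0|t0] := ltP t 0; first by rewrite /theta lt0_powR1 // ltr1n.
apply: (@le_lt_trans _ _ 1); last by rewrite ltr1n.
by rewrite -theta1; apply: ge0_ler_powR; rewrite ?nnegrE // ltW.
Qed.

Let theta_cvg0 : theta t @[t --> 0^'+] --> 0.
Proof. exact: powR_cvg0. Qed.

Let theta_cont t : 0 < t -> {for t, continuous theta}.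
Proof.
move=> t0; apply: differentiable_continuous; apply/derivable1_diffP.
by have [] := is_derive_theta t0.
Qed.

Let theta_cvg1 : theta t @[t --> 1^'-] --> (1 : R).
Proof. by rewrite -[X in _ --> X]theta1; apply: cvg_at_left_filter; exact: theta_cont. Qed.

Let continuous_comp_theta (Psi : R -> R) :
  (forall y, y < 2 -> {for y, continuous Psi}) ->
  {within `[0, 1], continuous (fun t => Psi (theta t))}.
Proof.
move=> cPsi; apply/(continuous_within_itvP _ ltr01); split.
- move=> t; rewrite in_itv /= => /andP[t0 t1].
  apply: (@continuous_comp _ _ _ theta Psi); first exact: theta_cont.
  exact/cPsi/theta_lt2/ltW.
- rewrite theta0; apply: cvg_comp theta_cvg0 _; exact: cPsi.
- rewrite theta1; apply: cvg_comp theta_cvg1 _; apply: cPsi; exact: ltr1n.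
Qed.

Let is_derive_powR_sub (b y : R) : y < 2 ->
  is_derive y 1 (fun z : R => (2 - z) `^ b) (- (b * (2 - y) `^ (b - 1))).
Proof.
move=> y2; have y0 : 0 < 2 - y by rewrite subr_gt0.
have dw : is_derive y 1 (fun z : R => 2 - z) (-1).
  by apply: is_derive_eq; rewrite add0r mul1r.
have := @is_derive1_comp _ (fun x : R => x `^ b) (fun z : R => 2 - z) y _ _
  (is_derive1_powR b y0) dw.
by rewrite mulrN1.
Qed.

Let continuous_powR_sub (b y : R) : y < 2 ->
  {for y, continuous (fun z : R => (2 - z) `^ b)}.
Proof.
move=> y2; apply: differentiable_continuous; apply/derivable1_diffP.
by have [] := is_derive_powR_sub b y2.
Qed.

Let continuous_horner_sub S (b y : R) :
  {for y, continuous (fun z : R => S.[b * (1 - z)])}.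
Proof.
have -> : (fun z : R => S.[b * (1 - z)]) = horner (S \Po (b *: (1 - 'X))).
  by apply/funext => z /=; rewrite horner_comp !hornerE.
exact: continuous_horner.
Qed.

(** With y = 1 - t^a, the integrand is the derivative of S(y) t (1 + y)^(1/a), which
    is S(y) (1 - y^2)^(1/a); it vanishes at t = 0 and equals S(0) at t = 1. *)
Lemma jacobi_pearson S :
  (\int[leb]_(t in `[0%R, 1%R]) (((2 *: ('X * S) - a *: ((1 - 'X^2) * S^`())).[1 - t `^ a]
    * jacobi_density t))%:E = S.[0]%:E)%E.
Proof.
set q := _ - _.
pose Phi z := S.[1 * (1 - z)] * (2 - z) `^ (a^-1).
pose F t := Phi (theta t) * t.
have cPhi y : y < 2 -> {for y, continuous Phi}.
  move=> y2; apply: continuousM; first exact: continuous_horner_sub.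
  exact: continuous_powR_sub.
have [_ Phi0 Phi1] := (continuous_within_itvP _ ltr01).1 (continuous_comp_theta cPhi).
have F0 : F t @[t --> 0^'+] --> F 0.
  by apply: cvgM Phi0 _; apply: cvg_at_right_filter; exact: cvg_id.
have F1 : F t @[t --> 1^'-] --> F 1.
  by apply: cvgM Phi1 _; apply: cvg_at_left_filter; exact: cvg_id.
have dF t : 0 < t < 1 -> is_derive t 1 F (q.[1 - t `^ a] * jacobi_density t).
  move=> /andP[t0 t1]; have y2 := theta_lt2 (ltW t1).
  have dpow := is_derive_powR_sub a^-1 y2.
  have dS : is_derive (theta t) 1 (fun z : R => S.[1 * (1 - z)]) (- S^`().[1 - theta t]).
    have dw : is_derive (theta t) 1 (fun z : R => 1 - z) (-1).
      by apply: is_derive_eq; rewrite add0r mul1r.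
    have := @is_derive1_comp _ (horner S) (fun z : R => 1 - z) (theta t) _ _
      (is_derive_poly S _) dw.
    under [X in _ -> is_derive _ _ X _]eq_fun do rewrite mul1r.
    by rewrite mulrN1.
  have dPhi : is_derive (theta t) 1 Phi
     (S.[1 - theta t] * - (a^-1 * (2 - theta t) `^ (a^-1 - 1))
      + (2 - theta t) `^ a^-1 * - S^`().[1 - theta t]).
    have := is_deriveM dS dpow; rewrite mul1r; exact.
  have dPt := @is_derive1_comp _ Phi theta t _ _ dPhi (is_derive_theta t0).
  have dFt := is_deriveM dPt (@is_derive_id R R t 1).
  have -> : F = (Phi \o theta) * id by [].
  apply: is_derive_eq; rewrite /GRing.scale /=.
  have e1 : t * t `^ (a - 1) = theta t by rewrite mulr_powRB1 // ltW.
  have e2 : (2 - theta t) `^ a^-1 = (2 - theta t) * (2 - theta t) `^ (a^-1 - 1).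
    by rewrite mulr_powRB1 ?invr_gt0 // subr_ge0 ltW.
  rewrite /Phi mul1r e2 /q !hornerE /jacobi_density -/(theta t) /=.
  set y := theta t in e1 *; set H := _ `^ _.
  transitivity (S.[1 - y] * (2 - y) * H + (S.[1 - y] * - (a^-1 * H)
    + (2 - y) * H * - S^`().[1 - y]) * a * (t * t `^ (a - 1))); first by ring.
  by rewrite e1; field; rewrite gt_eqF.
have F0E : F 0 = 0 by exact: mulr0.
have F1E : F 1 = S.[0].
  have -> : F 1 = S.[1 * (1 - 1)] * (2 - 1) `^ a^-1 * 1 by rewrite /F /Phi theta1.
  by rewrite subrr mul1r mulr1 (_ : 2 - 1 = 1 :> R) ?powR1 ?mulr1 //; ring.
have FF : F 1 - F 0 = S.[0].
  exact: etrans (congr2 (fun u v : R => u - v) F1E F0E) (subr0 _).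
transitivity ((F 1)%:E - (F 0)%:E)%E; last exact: (congr1 EFin FF).
apply: (@continuous_FTC2 _ (fun t => q.[1 - t `^ a] * jacobi_density t) F).
- exact: ltr01.
- apply: (@continuous_comp_theta (fun z => q.[1 - z] * (2 - z) `^ (a^-1 - 1))).
  move=> y y2; apply: continuousM; last exact: continuous_powR_sub.
  have -> : (fun z : R => q.[1 - z]) = (fun z => q.[1 * (1 - z)]).
    by apply/funext => z; rewrite mul1r.
  exact: continuous_horner_sub.
- split; last exact: F1.
  + by move=> t; rewrite in_itv /= => /dF[].
  + exact: F0.
- by move=> t; rewrite in_itv /= derive1E => /dF[_ ->].
Qed.

Lemma jacobi_density_gt0 t : t <= 1 -> 0 < jacobi_density t.
Proof. by move=> t1; rewrite powR_gt0 // subr_gt0 theta_lt2. Qed.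

Let weight : R -> R := jacobi_density \_ `[0, 1].

Let weight_ge0 t : 0 <= weight t.
Proof.
rewrite /weight patchE; case: ifPn => // /set_mem /=.
by rewrite in_itv /= => /andP[_ /jacobi_density_gt0 /ltW].
Qed.

Let weight_itv (f : R -> R) :
  EFin \o (fun t => f t * weight t) =
  (EFin \o (fun t => f t * jacobi_density t)) \_ `[0, 1].
Proof.
apply/funext => t; rewrite /weight /= !patchE; case: ifPn => //= _.
by rewrite mulr0.
Qed.

Lemma integrable_jacobi s S :
  leb.-integrable `[0, 1] (EFin \o (fun t => S.[s * (1 - t `^ a)] * jacobi_density t)).
Proof.
apply: continuous_compact_integrable; first exact: segment_compact.
apply: (@continuous_comp_theta (fun z => S.[s * (1 - z)] * (2 - z) `^ (a^-1 - 1))).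
move=> y y2; apply: continuousM; first exact: continuous_horner_sub.
exact: continuous_powR_sub.
Qed.

Let integrable_weight s S :
  leb.-integrable setT (EFin \o (fun t => S.[s * (1 - t `^ a)] * weight t)).
Proof.
rewrite weight_itv; apply/integrable_restrict => //.
by rewrite setTI; exact: integrable_jacobi.
Qed.

(** The weight is even while the substitution only covers one half of the interval;
    the other half is the mirror image. *)
Lemma jacobi_measure (rho : R) : 0 < rho ->
  exists mu : {measure set (measurableTypeR R) -> \bar R},
  [/\ infinite_set (measure_support mu),
      forall S, mu.-integrable setT (EFin \o horner S) &
      forall S, poly_integral mu S = \int[leb]_(t in `[0, 1])
        ((S.[rho * (1 - t `^ a)] + S.[- rho * (1 - t `^ a)]) * jacobi_density t)].
Proof.
move=> rho0.
have iw : leb.-integrable setT (EFin \o weight).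
  have -> : weight = (fun t => (1 : {poly R}).[0 * (1 - t `^ a)] * weight t).
    by apply/funext => t; rewrite hornerC mul1r.
  exact: integrable_weight.
have [nu [nuE nuf]] := density_measure weight_ge0 iw.
pose psi s t : R := s * (1 - t `^ a).
have mpsi s : measurable_fun [set: measurableTypeR R] (psi s).
  by apply: measurable_funM => //; apply: measurable_funB => //; exact: measurable_powR.
have push s : exists mu : {measure set (measurableTypeR R) -> \bar R},
   [/\ forall A, mu A = nu (psi s @^-1` A),
       forall S, mu.-integrable setT (EFin \o horner S) &
       forall S, \int[mu]_x S.[x] =
         \int[leb]_(t in `[0, 1]) (S.[psi s t] * jacobi_density t)].
  have [mu [muE muf]] := image_measure nu (mpsi s).
  have mSpsi S : measurable_fun setT (fun t => S.[psi s t]).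
    exact: (measurableT_comp (measurable_horner S) (mpsi s)).
  exists mu; split=> // S; have [inu eqnu] := nuf _ (mSpsi S) (integrable_weight s S).
    by have [] := muf _ (measurable_horner S) inu.
  have [_ ->] := muf _ (measurable_horner S) inu; rewrite eqnu.
  rewrite /Rintegral [in RHS]integral_mkcond; congr fine.
  have e := weight_itv (fun t => S.[psi s t]).
  by apply: eq_integral => t _; have := congr1 (fun f => f t) e.
have [m1 [m1E i1 e1]] := push rho; have [m2 [m2E i2 e2]] := push (- rho).
pose mu : {measure set (measurableTypeR R) -> \bar R} := measure_add m1 m2.
have mE S : measurable_fun [set: measurableTypeR R] (EFin \o horner S).
  exact: measurable_int (i1 S).
exists mu; split.
- apply: (infinite_itv rho0) => x /=; rewrite in_itv /= => /andP[x0 x_rho] U oU Ux.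
  have mU : measurable (U : set (measurableTypeR R)) by exact: open_measurable.
  rewrite [X in (_ < X)%E]measure_addE.
  apply: (@lt_le_trans _ _ (m1 U)); last by rewrite leeDl.
  (* t0 is the parameter that is mapped to x *)
  pose z := 1 - x / rho; pose t0 := z `^ a^-1.
  have /andP[z0 z1] : 0 < z < 1.
    by rewrite subr_gt0 ltr_pdivrMr // mul1r x_rho gtrBl divr_gt0.
  have t00 : 0 < t0 by rewrite powR_gt0.
  have t01 : t0 < 1.
    have <- : 1 `^ a^-1 = 1 :> R by rewrite powR1.
    by apply: gt0_ltr_powR; rewrite ?nnegrE ?invr_gt0 // ltW.
  have psi_t0 : psi rho t0 = x.
    have -> : psi rho t0 = rho * (1 - z).
      by rewrite /psi /t0 -powRrM mulVf ?gt_eqF // powRr1 // ltW.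
    by rewrite /z; field; rewrite gt_eqF.
  have cpsi : {for t0, continuous (psi rho)}.
    by apply: cvgM; [exact: cvg_cst|apply: cvgB; [exact: cvg_cst|exact: theta_cont]].
  have : nbhs t0 (psi rho @^-1` U).
    by apply: cpsi; rewrite psi_t0; exact: open_nbhs_nbhs.
  move=> /nbhs_ballP[e /= e0 sub].
  have mpsiU : measurable (psi rho @^-1` U : set (measurableTypeR R)).
    by rewrite -[X in measurable X]setTI; exact: mpsi.
  rewrite m1E nuE //.
  apply: (@density_itv_gt0 _ _ (Num.max 0 (t0 - e)) (Num.min 1 (t0 + e))) => //.
  + by rewrite lt_min !gt_max; apply/andP; split; apply/andP; split; lra.
  + move=> t /=; rewrite in_itv /= lt_min gt_max => /andP[/andP[t_0 t_1] /andP[t_2 t_3]].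
    by apply: sub; rewrite /ball /= ltr_distlC t_1 t_3.
  + by apply/measurable_EFinP; exact: measurable_int iw.
  + move=> t; rewrite lt_min gt_max => /andP[/andP[t_0 _] /andP[t_1 _]].
    rewrite /weight patchE mem_set; first exact/jacobi_density_gt0/ltW.
    by rewrite /= in_itv /= !ltW.
- move=> S; apply/integrableP; split=> //.
  rewrite ge0_integral_measure_add //; last exact: measurableT_comp.
  have [_ l1] := integrableP _ _ _ (i1 S); have [_ l2] := integrableP _ _ _ (i2 S).
  exact: lte_add_pinfty.
- move=> S; rewrite /poly_integral {1}/Rintegral.
  rewrite (integral_measure_add measurableT (i1 S) (i2 S)) //.
  rewrite fineD; [|exact: integrable_fin_num..].
  transitivity (\int[m1]_x S.[x] + \int[m2]_x S.[x]) => //.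
  rewrite e1 e2 -RintegralD //; [|exact: integrable_jacobi..].
  by apply: eq_Rintegral => t _; rewrite mulrDl.
Qed.

End Ultraspherical.

(** The odd polynomial S(y) = p(rho y) - p(- rho y) vanishes at 0, so the boundary
    terms of the two halves of the interval cancel in [jacobi_pearson]. *)
Lemma ultraspherical_measure (R : realType) (alpha A B : R) : 0 < alpha -> 0 < B ->
  0 < 2 * A + 3 * B ->
  exists mu : {measure set (measurableTypeR R) -> \bar R},
  [/\ infinite_set (measure_support mu),
      forall k : nat, mu.-integrable setT (fun x : R => (x ^+ k)%:E) &
      forall p : {poly R}, poly_integral mu (((4 * alpha)%:P - B *: 'X^2) * p^`()
                       - (2 * A + 3 * B) *: ('X * p)) = 0].
Proof.
move=> alpha0 B0; set w := 2 * A + 3 * B => w0.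
pose rho := Num.sqrt (4 * alpha / B).
have rho0 : 0 < rho by rewrite sqrtr_gt0 divr_gt0 // mulr_gt0.
have rho2 : 4 * alpha = B * rho ^+ 2.
  rewrite sqr_sqrtr; last by rewrite divr_ge0 ?mulr_ge0 // ltW.
  by field; rewrite gt_eqF.
(* rho makes 4 alpha - B x^2 vanish at the end points; eps = w / B, a = 2 / eps *)
pose a := 2 * B / w.
have a0 : 0 < a by rewrite divr_gt0 // mulr_gt0.
have [mu [supp imu muE]] := jacobi_measure a0 rho0.
exists mu; split=> //.
  move=> k; have := imu ('X^k).
  have -> : EFin \o horner 'X^k = (fun x : R => (x ^+ k)%:E).
    by apply/funext => x /=; rewrite hornerXn.
  by [].
move=> p; rewrite muE.
pose S := (p \Po (rho *: 'X)) - (p \Po (- rho *: 'X)).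
have S0 : S.[0] = 0 by rewrite /S hornerD hornerN !horner_comp !hornerZ !hornerX !mulr0 subrr.
have := jacobi_pearson a0 S; rewrite S0 => /(congr1 fine) /= pearson.
set q := (2 *: ('X * S) - a *: ((1 - 'X^2) * S^`())) in pearson.
(* the factor - w rho / 2 matches the terms in y (p(rho y) - p(- rho y)) *)
transitivity (\int[lebesgue_measure]_(t in `[0, 1])
   (- (w * rho / 2) * (q.[1 - t `^ a] * jacobi_density a t))).
  apply: eq_Rintegral => t _; move: (1 - t `^ a) => y.
  rewrite mulrA; congr (_ * _).
  rewrite /q /S derivB !deriv_comp !derivZ !derivX !hornerE !horner_comp !hornerE /=.
  by rewrite rho2 /a; field; rewrite gt_eqF.
rewrite RintegralZl //; first by rewrite /Rintegral pearson mulr0.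
have -> : (fun t => q.[1 - t `^ a] * jacobi_density a t) =
  (fun t => q.[1 * (1 - t `^ a)] * jacobi_density a t).
  by apply/funext => t; rewrite mul1r.
exact: integrable_jacobi.
Qed.

(** * The classification *)

Section Classification.
Variables (R : realType) (alpha c : R) (F : nat -> R).
Hypotheses (alpha_gt0 : 0 < alpha) (F0 : F 0%N = 1) (F1 : F 1%N = c).
Hypothesis c_neq0 : c != 0.

Local Notation P n := (monic_multiple (coef_subst F (xz_sub_zz 1 alpha) n)).

Lemma genP_monic n : F n != 0 -> P n \is monic /\ size (P n) = n.+1.
Proof.
move=> Fn; have p0 : coef_subst F (xz_sub_zz 1 alpha) n != 0.
  by rewrite -size_poly_eq0 size_coef_subst ?oner_eq0.
split; first by rewrite monicE lead_coefZ mulVf // lead_coef_eq0.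
by rewrite size_scale ?invr_neq0 ?lead_coef_eq0 // size_coef_subst ?oner_eq0.
Qed.

Lemma genP_parity n m : F n != 0 -> odd (n - m) -> (P n)`_m = 0.
Proof.
move=> Fn odd_nm; rewrite monic_multiple_coef_subst ?oner_eq0 // coefZ.
by rewrite coef_coef_subst odd_nm andbF mulr0.
Qed.

Lemma OPF_coef_recurrence : is_OPF (genP alpha F) ->
  (forall n, F n != 0) /\
  exists A B : R, [/\ 0 <= B, 0 < 2 * A + 3 * B & coef_recurrence A B F].
Proof.
move=> [Q [PQ [sizeQ [mu [supp moments orth]]]]].
have F_neq0 n : F n != 0 by exact: genP_neq0 (PQ n).
have QE n : Q n = P n.
  by have := PQ n; rewrite genP_Some // => -[].
split=> //; apply: (coef_ratio_affine alpha_gt0 F_neq0) => n.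
apply: (@three_term R (poly_integral mu) (poly_integral_linear moments) _ (fun n => P n)).
- by move=> p; exact: poly_integral_sqr_gt0.
- by move=> k; exact: (genP_monic (F_neq0 k)).2.
- move=> j k neq_jk; rewrite /poly_integral /Rintegral.
  under eq_integral do rewrite hornerM -!QE.
  by rewrite orth.
- by move=> k; exact: (genP_monic (F_neq0 k)).1.
- by move=> j k; exact: genP_parity.
Qed.

Lemma coef_recurrence_OPF A B : (forall n, F n != 0) -> 0 <= B ->
  0 < 2 * A + 3 * B -> coef_recurrence A B F -> is_OPF (genP alpha F).
Proof.
move=> F_neq0 B0 AB0 rF; exists (fun n => P n); split.
  by move=> n; rewrite genP_Some.
split; first by move=> n; exact: (genP_monic (F_neq0 n)).2.
have [mu [supp moments pearson]] :
    exists mu : {measure set (measurableTypeR R) -> \bar R},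
    [/\ infinite_set (measure_support mu),
      forall k : nat, mu.-integrable setT (fun x : R => (x ^+ k)%:E) &
      forall p : {poly R}, poly_integral mu (((4 * alpha)%:P - B *: 'X^2) * p^`()
                       - (2 * A + 3 * B) *: ('X * p)) = 0].
  move: B0; rewrite le_eqVlt => /orP[/eqP B_eq0|B0]; last first.
    exact: ultraspherical_measure.
  have A0 : 0 < A by move: AB0; rewrite -B_eq0; lra.
  have [mu [supp moments pearson]] := gaussian_measure alpha_gt0 A0.
  exists mu; split=> // p; rewrite -B_eq0 scale0r subr0 mulr0 addr0 mul_polyC.
  exact: pearson.
exists mu; split=> // m n neq_mn.
have orth : poly_integral mu (P m * P n) = 0.
  exact: (ode_orthogonal B0 AB0 (poly_integral_linear moments) pearson
    (fun n => monic_ode alpha n F_neq0 rF) neq_mn).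
transitivity (poly_integral mu (P m * P n))%:E; last by rewrite orth.
rewrite EFin_poly_integral //.
by apply: eq_integral => x _; rewrite hornerM.
Qed.

Lemma rescaled_ultraspherical_OPF lambda b : - 2^-1 < lambda ->
  lambda != 0 -> 0 < b -> rescaled_ultraspherical alpha lambda b (genP alpha F) ->
  is_OPF (genP alpha F).
Proof.
move=> l2 l0 b0 resc.
have F_neq0 n : F n != 0 by exact: genP_neq0 (resc n).
have FE := (rescaled_ultrasphericalP alpha_gt0 F0 F1 c_neq0 l2 l0 b0).1 resc.
apply: (@coef_recurrence_OPF (b * (lambda - 1)) b) => //; first exact: ltW.
  have -> : 2 * (b * (lambda - 1)) + 3 * b = b * (2 * lambda + 1) by ring.
  by rewrite mulr_gt0 //; lra.
apply: (coef_recurrence_eq (G := fun n => c / (b * lambda) * (b ^+ n * ultra_coef lambda n))).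
  exact: FE.
exact/coef_recurrenceZ/coef_recurrence_ultra.
Qed.

Lemma rescaled_chebyshevT_OPF b : 0 < b ->
  rescaled_chebyshevT alpha b (genP alpha F) -> is_OPF (genP alpha F).
Proof.
move=> b0 resc.
have F_neq0 n : F n != 0 by have [T _ /genP_neq0] := resc n.
have FE := (rescaled_chebyshevT_coefP alpha_gt0 F0 F1 c_neq0 b0).1 resc.
apply: (@coef_recurrence_OPF (- b) b) => //; [exact: ltW|lra|].
apply: (coef_recurrence_eq (G := fun n => c / b * (b ^+ n * n%:R^-1))).
  exact: FE.
exact/coef_recurrenceZ/coef_recurrence_log.
Qed.

Lemma rescaled_hermite_OPF a : 0 < a ->
  rescaled_hermite alpha a (genP alpha F) -> is_OPF (genP alpha F).
Proof.
move=> a0 resc.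
have F_neq0 n : F n != 0 by exact: genP_neq0 (resc n).
have FE := (rescaled_hermiteP alpha_gt0 F0 F1 c_neq0 a0).1 resc.
apply: (@coef_recurrence_OPF a 0) => //; [lra|].
apply: (coef_recurrence_eq (G := fun n => c / a * (a ^+ n * n`!%:R^-1))).
  exact: FE.
exact/coef_recurrenceZ/coef_recurrence_exp.
Qed.

Lemma OPF_classification : is_OPF (genP alpha F) ->
  [\/ exists lambda b : R, [/\ - 2^-1 < lambda, lambda != 0, 0 < b
           & rescaled_ultraspherical alpha lambda b (genP alpha F)],
      exists b : R, 0 < b /\ rescaled_chebyshevT alpha b (genP alpha F)
    | exists a : R, 0 < a /\ rescaled_hermite alpha a (genP alpha F)].
Proof.
move=> /OPF_coef_recurrence[F_neq0 [A [B [B0 AB0 rF]]]].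
move: B0; rewrite le_eqVlt => /orP[/eqP B_eq0|B0].
  rewrite -B_eq0 in AB0 rF.
  have A0 : 0 < A by move: AB0; lra.
  apply: Or33; exists A; split=> //.
  apply/(rescaled_hermiteP alpha_gt0 F0 F1 c_neq0 A0).
  apply: (coef_recurrence_unique (G := fun n => c / A * (A ^+ n * n`!%:R^-1)) rF).
    exact/coef_recurrenceZ/coef_recurrence_exp.
  by rewrite F1 expr1 invr1 mulr1 divfK // gt_eqF.
pose lambda := A / B + 1.
have AE : A = B * (lambda - 1) by rewrite /lambda; field; rewrite gt_eqF.
have l2 : - 2^-1 < lambda.
  have : 0 < B * (2 * lambda + 1).
    by move: AB0; rewrite AE; congr (_ < _); ring.
  by rewrite pmulr_rgt0 //; lra.
have [l0|l0] := eqVneq lambda 0.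
  apply: Or32; exists B; split=> //.
  apply/(rescaled_chebyshevT_coefP alpha_gt0 F0 F1 c_neq0 B0).
  rewrite AE l0 sub0r mulrN1 in rF.
  apply: (coef_recurrence_unique (G := fun n => c / B * (B ^+ n * n%:R^-1)) rF).
    exact/coef_recurrenceZ/coef_recurrence_log.
  by rewrite F1 expr1 invr1 mulr1 divfK // gt_eqF.
apply: Or31; exists lambda, B; split=> //.
apply/(rescaled_ultrasphericalP alpha_gt0 F0 F1 c_neq0 l2 l0 B0).
rewrite AE in rF.
apply: (coef_recurrence_unique (G := fun n => c / (B * lambda) * (B ^+ n * ultra_coef lambda n)) rF).
  exact/coef_recurrenceZ/coef_recurrence_ultra.
by rewrite F1 expr1 ultra_coef1 divfK // mulf_neq0 // gt_eqF.
Qed.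

End Classification.

Theorem theorem1 (R : realType) (alpha c : R) (F : nat -> R)
    (alpha_gt0 : 0 < alpha) (F0 : F 0%N = 1) (F1 : F 1%N = c) (c_neq0 : c != 0) :
  (is_OPF (genP alpha F) <->
     [\/ exists lambda b : R, [/\ - 2^-1 < lambda, lambda != 0, 0 < b
           & rescaled_ultraspherical alpha lambda b (genP alpha F)],
         exists b : R, 0 < b /\ rescaled_chebyshevT alpha b (genP alpha F)
       | exists a : R, 0 < a /\ rescaled_hermite alpha a (genP alpha F)]) /\
  (is_OPF (genP alpha F) ->
     forall n, exists2 p : {poly R}, genP alpha F n = Some p & p \is monic) /\
  (forall lambda b : R, - 2^-1 < lambda -> lambda != 0 -> 0 < b ->
     (rescaled_ultraspherical alpha lambda b (genP alpha F) <->
      F =1 taylor0 (F_ultraspherical c lambda b))) /\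
  (forall b : R, 0 < b ->
     (rescaled_chebyshevT alpha b (genP alpha F) <->
      F =1 taylor0 (F_chebyshevT c b))) /\
  (forall a : R, 0 < a ->
     (rescaled_hermite alpha a (genP alpha F) <->
      F =1 taylor0 (F_hermite c a))) /\
  (forall lambda : R, - 2^-1 < lambda -> lambda != 0 ->
     taylor0 (F_ultraspherical lambda lambda 1)
       =1 taylor0 (fun z : R => 1 / (1 - z) `^ lambda)) /\
  (taylor0 (@F_chebyshevT R 1 1) =1 taylor0 (fun z : R => 1 + ln (1 / (1 - z)))) /\
  (taylor0 (@F_hermite R 1 1) =1 taylor0 (@expR R)).
Proof.
split; [split|split; [|split; [|split; [|split; [|split; [|split]]]]]].
- exact: (OPF_classification alpha_gt0 F0 F1 c_neq0).
- case=> [[lambda [b [l2 l0 b0]]]|[b [b0]]|[a [a0]]].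
  + exact: (rescaled_ultraspherical_OPF alpha_gt0 F0 F1 c_neq0).
  + exact: (rescaled_chebyshevT_OPF alpha_gt0 F0 F1 c_neq0).
  + exact: (rescaled_hermite_OPF alpha_gt0 F0 F1 c_neq0).
- move=> /(OPF_coef_recurrence alpha_gt0)[F_neq0 _] n.
  by eexists; [exact: genP_Some|exact: (genP_monic _ (F_neq0 n)).1].
- move=> lambda b l2 l0 b0.
  by rewrite (rescaled_ultrasphericalP alpha_gt0 F0 F1) // (eq_taylor0_ultraspherical c F0).
- move=> b b0.
  by rewrite (rescaled_chebyshevT_coefP alpha_gt0 F0 F1) // (eq_taylor0_chebyshevT c F0).
- move=> a a0.
  by rewrite (rescaled_hermiteP alpha_gt0 F0 F1) // (eq_taylor0_hermite c F0).
- by move=> lambda _ l0; rewrite F_ultraspherical_standard.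
- by rewrite F_chebyshevT_standard.
- by rewrite F_hermite_standard.
Qed.
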